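(* Let $\mathfrak{q}=\mathfrak{l}\oplus\mathfrak{g}(1)\oplus\mathfrak{z}(\mathfrak{n})$ be a maximal parabolic subalgebra as below and let $V(\nu)$ be an irreducible constituent of the $L$-module $\mathfrak{l}_\gamma\otimes\mathfrak{z}(\mathfrak{n})$. (1) If $\mathfrak{q}$ is of type $B_n(i)$ ($3\le i\le n$) or $D_n(i)$ ($3\le i\le n-3$), then $V(\nu)$ is a special constituent if and only if $\nu=2\varepsilon_1$. (2) If $\mathfrak{q}$ is of type $C_n(i)$ ($2\le i\le n-1$), then $V(\nu)$ is a special constituent if and only if $\nu=\varepsilon_1+\varepsilon_2$.
   Context: $\mathfrak{g}$ is a complex simple Lie algebra with Borel subalgebra $\mathfrak{b}\supset\mathfrak{h}$ (Cartan), roots $\Delta$, simple roots $\Pi$, in the standard realization via $\varepsilon_1,\dots,\varepsilon_n$. ''$\mathfrak{q}$ is of type $\mathcal{T}(i)$'' means $\mathfrak{g}$ has type $\mathcal{T}$ and $\mathfrak{q}=\mathfrak{l}\oplus\mathfrak{n}$ is the standard maximal parabolic determined by $\alpha_\mathfrak{q}=\alpha_i$ (Bourbaki numbering): $\mathfrak{l}=\mathfrak{h}$ plus root spaces for roots in $\mathrm{span}(\Pi\setminus\{\alpha_\mathfrak{q}\})$, $\mathfrak{n}$ the remaining positive root spaces. $\mathfrak{n}=\mathfrak{g}(1)\oplus\mathfrak{z}(\mathfrak{n})$, where $\mathfrak{g}(1)$ (resp. the center $\mathfrak{z}(\mathfrak{n})$) is the sum of the root spaces of roots with $\alpha_\mathfrak{q}$-coefficient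 $1$ (resp. $2$). $L$ is the Levi subgroup with Lie algebra $\mathfrak{l}$, acting by $\mathrm{Ad}$. $\Delta(W)$ denotes the roots whose root spaces lie in $W$. $\mu$ is the highest weight of the irreducible $L$-module $\mathfrak{g}(1)$ and $\gamma$ (the highest root) that of $\mathfrak{z}(\mathfrak{n})$. $\mathfrak{l}_\gamma$ is the simple ideal of $[\mathfrak{l},\mathfrak{l}]$ containing the root space of the unique simple root $\alpha_\gamma$ not orthogonal to $\gamma$ (here its simple roots are $\alpha_1,\dots,\alpha_{i-1}$). $V(\nu)$ denotes an irreducible constituent with highest weight $\nu$ (a weight of $\mathfrak{h}$). A constituent $V(\nu)$ of $\mathfrak{l}\otimes\mathfrak{z}(\mathfrak{n})$ is special if $\nu\neq\gamma$ and there is $\epsilon\in\Delta(\mathfrak{g}(1))$ with $\nu=\mu+\epsilon$. *)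

(* Defs.v *)
(* The complex numbers are R[i] for R : realType. *)
From HB Require Import structures.
From mathcomp Require Import all_boot all_order all_algebra.
From mathcomp Require Export reals.
From mathcomp Require Export complex.

Set Implicit Arguments.
Unset Strict Implicit.
Unset Printing Implicit Defensive.

Import Order.TTheory GRing.Theory Num.Theory.
Local Open Scope ring_scope.

Record lieBracket (F : numFieldType) (V : vectType F) := LieBracket {
  lie_br :> V -> V -> V;
  lie_linl : forall z, linear (lie_br^~ z);
  lie_linr : forall x, linear (lie_br x);
  lie_alt : forall x, lie_br x x = 0;
  lie_jacobi : forall x y z,
    lie_br x (lie_br y z) + lie_br y (lie_br z x) + lie_br z (lie_br x y) = 0 }.

HB.instance Definition _ (F : numFieldType) (V : vectType F) (br : lieBracket V)
    (x : V) :=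
  GRing.isLinear.Build F V V *:%R (lie_br br x) (lie_linr br x).

Section LieAlgebra.
Variables (F : numFieldType) (V : vectType F) (br : lieBracket V).

Definition ad (x : V) : 'End(V) := linfun (br x).

Lemma adE x y : ad x y = br x y.
Proof. exact: lfunE. Qed.

Definition derived (A : {vspace V}) : {vspace V} :=
  <<[seq br x y | x <- vbasis A, y <- vbasis A]>>%VS.

Definition is_ideal (I A : {vspace V}) : Prop :=
  (I <= A)%VS /\ forall x y, x \in A -> y \in I -> br x y \in I.

(* A is meant to be a subalgebra. *)
Definition simple_lie (A : {vspace V}) : Prop :=
  (exists x y, [/\ x \in A, y \in A & br x y != 0]) /\
  forall I, is_ideal I A -> I = 0%VS \/ I = A.

Definition abelian_lie (A : {vspace V}) : Prop :=
  forall x y, x \in A -> y \in A -> br x y = 0.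

Definition ad_semisimple (x : V) : Prop :=
  exists X : seq V, basis_of fullv X /\
    forall y, y \in X -> exists c : F, br x y = c *: y.

(* Cartan subalgebra of a semisimple Lie algebra over an algebraically closed
   field of characteristic 0: a maximal abelian subalgebra all of whose
   elements are ad-semisimple. *)
Definition cartan_subalgebra (h : {vspace V}) : Prop :=
  [/\ abelian_lie h,
      forall A, abelian_lie A -> (h <= A)%VS -> A = h
    & forall x, x \in h -> ad_semisimple x].

Definition in_center (A : {vspace V}) (z : V) : Prop :=
  z \in A /\ forall x, x \in A -> br x z = 0.

Definition ad_pow (x : V) (k : nat) : 'End(V) :=
  iter k (comp_lfun (ad x)) \1%VF.

(* The adjoint group Int(g), generated by the exp(ad x) with x ad-nilpotent;
   it is closed under inverses since exp(ad x)^-1 = exp(ad (- x)). *)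
Inductive inner_aut : 'End(V) -> Prop :=
| inner_id : inner_aut \1%VF
| inner_exp x m f : ad_pow x m = 0 -> inner_aut f ->
    inner_aut ((\sum_(k < m) (k`!%:R)^-1 *: ad_pow x k) \o f)%VF.

(* Ad(L) for the Levi subgroup L with Lie algebra l: the centralizer in
   Int(g) of the center of l. *)
Definition levi_group (l : {vspace V}) (f : 'End(V)) : Prop :=
  inner_aut f /\ forall z, in_center l z -> f z = z.

End LieAlgebra.

(* The tensor product V (x) V, in coordinates with respect to the basis
   (e_a (x) e_b) where (e_a) = vbasis {:V}. *)
Section TensorSquare.
Variables (F : numFieldType) (V : vectType F).

Definition tensor := 'M[F]_(\dim {:V}, \dim {:V}).

Definition tens (x y : V) : tensor :=
  \matrix_(a, b) (coord (vbasis {:V}) a x * coord (vbasis {:V}) b y).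

Definition tens_map (f g : 'End(V)) (M : tensor) : tensor :=
  \sum_a \sum_b M a b *: tens (f (vbasis {:V})`_a) (g (vbasis {:V})`_b).

Lemma tens_mapE f g x y : tens_map f g (tens x y) = tens (f x) (g y).
Proof.
have E (k : 'End(V)) z c : coord (vbasis {:V}) c (k z) =
    \sum_a coord (vbasis {:V}) a z * coord (vbasis {:V}) c (k (vbasis {:V})`_a).
  rewrite {1}(coord_vbasis (memvf z)) !linear_sum /=.
  by apply: eq_bigr => a _; rewrite !linearZ.
apply/matrixP => c d; rewrite /tens_map mxE (E f) (E g) summxE big_distrl /=.
apply: eq_bigr => a _; rewrite summxE big_distrr /=.
by apply: eq_bigr => b _; rewrite !mxE mulrACA.
Qed.

Definition tens_space (A B : {vspace V}) : {vspace tensor} :=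
  <<[seq tens x y | x <- vbasis A, y <- vbasis B]>>%VS.

Definition tens_stable (G : 'End(V) -> Prop) (W : {vspace tensor}) : Prop :=
  forall f M, G f -> M \in W -> tens_map f f M \in W.

(* By complete reducibility an irreducible constituent of the G-module A is
   the same thing as an irreducible G-submodule of A. *)
Definition irreducible_constituent (G : 'End(V) -> Prop)
    (A W : {vspace tensor}) : Prop :=
  [/\ (W <= A)%VS, W != 0%VS, tens_stable G W
    & forall U, (U <= W)%VS -> tens_stable G U -> U = 0%VS \/ U = W].

Definition tens_ad (br : lieBracket V) (x : V) (M : tensor) : tensor :=
  tens_map (ad br x) \1%VF M + tens_map \1%VF (ad br x) M.

End TensorSquare.

Section RootSpaces.
Variables (F : numFieldType) (V : vectType F).
Variables (br : lieBracket V) (h : {vspace V}).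

Definition weight := 'Hom(subvs_of h, F^o).

Definition root_space (alpha : weight) : {vspace V} :=
  (\bigcap_(H <- vbasis {:subvs_of h})
     lker (ad br (vsval H) - (alpha H : F) *: \1%VF))%VS.

Lemma root_spaceP alpha x : x \in root_space alpha <->
  forall H : subvs_of h, br (vsval H) x = (alpha H : F) *: x.
Proof.
have memE (H : subvs_of h) :
    (x \in lker (ad br (vsval H) - (alpha H : F) *: \1%VF)) =
    (br (vsval H) x == (alpha H : F) *: x).
  rewrite memv_ker add_lfunE opp_lfunE scale_lfunE id_lfunE adE.
  by rewrite subr_eq0.
split=> [xin H|xH]; last first.
  rewrite /root_space; elim/big_ind: _ => [|A B hA hB|H _].
  - exact: memvf.
  - by rewrite memv_cap hA.
  - by rewrite memE; apply/eqP.
have xb K : K \in tval (vbasis {:subvs_of h}) ->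
    br (vsval K) x = (alpha K : F) *: x.
  move: xin; rewrite /root_space.
  elim: (tval (vbasis {:subvs_of h})) => [//|J s IH].
  rewrite big_cons memv_cap memE => /andP[/eqP xJ /IH xs].
  by rewrite inE => /orP[/eqP->|/xs].
have linx := lie_linl br x.
have brD u v : br (u + v) x = br u x + br v x.
  by have := linx 1 u v; rewrite !scale1r.
have br0 : br 0 x = 0.
  by have := brD 0 0; rewrite addr0 => /eqP; rewrite -subr_eq subrr eq_sym => /eqP.
have brZ c u : br (c *: u) x = c *: br u x.
  by have := linx c u 0; rewrite !addr0 br0 addr0.
rewrite (coord_vbasis (memvf H)) !linear_sum /= scaler_suml.
rewrite (big_morph (fun u => br u x) brD br0).
apply: eq_bigr => k _; rewrite !linearZ /= brZ xb ?scalerA //.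
by apply: mem_nth; rewrite size_tuple.
Qed.

Definition is_root (alpha : weight) : Prop :=
  alpha != 0 /\ root_space alpha != 0%VS.

End RootSpaces.

Variant classicalType := TypeB | TypeC | TypeD.

(* Indices are shifted by one: epsilon_(k+1) is eps`_k, and alpha_(k+1) is
   tnth (simple_roots T eps) k in the Bourbaki numbering. *)
Section StandardRealization.
Variables (F : numFieldType) (V : vectType F) (h : {vspace V}).
Variables (T : classicalType) (n : nat) (eps : n.-tuple (weight h)).

Definition root_system : seq (weight h) :=
  [seq s.1 *: tnth eps p.1 + s.2 *: tnth eps p.2
     | p <- enum [pred p : 'I_n * 'I_n | p.1 < p.2]%N,
       s <- [:: (1, 1); (1, -1); (-1, 1); (-1, -1)] : seq (F * F)] ++
  match T with
  | TypeB => [seq s *: tnth eps k | k <- enum 'I_n, s <- [:: 1; -1]]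
  | TypeC => [seq s *: (tnth eps k *+ 2) | k <- enum 'I_n, s <- [:: 1; -1]]
  | TypeD => [::]
  end.

Definition simple_roots : n.-tuple (weight h) :=
  [tuple if (k.+1 < n)%N then eps`_k - eps`_k.+1
         else match T with
              | TypeB => eps`_k
              | TypeC => eps`_k *+ 2
              | TypeD => eps`_k.-1 + eps`_k
              end | k < n].

Definition root_coef (k : 'I_n) (alpha : weight h) : F :=
  coord simple_roots k alpha.

(* The inner product for which the epsilon_k are orthonormal. *)
Definition weight_dot (a b : weight h) : F :=
  \sum_k coord eps k a * coord eps k b.

End StandardRealization.

(* "g is of type T in the standard realization via eps": h is a Cartan
   subalgebra of the simple Lie algebra (V, br), eps is a basis of the dual
   of h, and the roots of (g, h) are those of the standard root system of
   type T; the Borel subalgebra is the one of simple_roots T eps. *)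
Definition standard_realization (F : numFieldType) (V : vectType F)
    (br : lieBracket V) (h : {vspace V}) (T : classicalType) (n : nat)
    (eps : n.-tuple (weight h)) : Prop :=
  [/\ simple_lie br fullv, cartan_subalgebra br h, basis_of fullv eps
    & forall alpha, is_root br alpha <-> alpha \in root_system T eps].

Section MaximalParabolic.
Variables (F : numFieldType) (V : vectType F) (br : lieBracket V).
Variables (h : {vspace V}) (T : classicalType) (n : nat).
Variables (eps : n.-tuple (weight h)) (i : 'I_n).

Local Notation Pi := (simple_roots T eps).
Local Notation Delta := (root_system T eps).

Definition levi_root (alpha : weight h) : bool :=
  alpha \in <<[seq b <- Pi | b != tnth Pi i]>>%VS.

Definition positive_root (alpha : weight h) : bool :=
  (alpha \in Delta) && [forall k, 0 <= root_coef T eps k alpha].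

Definition levi : {vspace V} :=
  (h + \sum_(alpha <- Delta | levi_root alpha) root_space br alpha)%VS.

Definition graded (d : nat) : {vspace V} :=
  (\sum_(alpha <- Delta | root_coef T eps i alpha == d%:R)
     root_space br alpha)%VS.

Definition g1 : {vspace V} := graded 1.

Definition zn : {vspace V} := graded 2.

Definition roots_in (W : {vspace V}) (alpha : weight h) : Prop :=
  alpha \in Delta /\ (root_space br alpha <= W)%VS.

(* nu is the highest weight (with respect to the Borel subalgebra b :&: l of l)
   of the irreducible submodule W of an l-module M with action act. *)
Definition highest_weight (M : vectType F) (act : V -> M -> M)
    (W : {vspace M}) (nu : weight h) : Prop :=
  exists w : M, [/\ w \in W, w != 0,
    forall H : subvs_of h, act (vsval H) w = (nu H : F) *: w
  & forall alpha x, positive_root alpha -> levi_root alpha ->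
      x \in root_space br alpha -> act x w = 0].

(* alpha_gamma is the simple root not orthogonal to gamma, and lg is the simple
   ideal of [l, l] containing its root space. *)
Definition is_l_gamma (gamma : weight h) (lg : {vspace V}) : Prop :=
  [/\ is_ideal br lg (derived br levi), simple_lie br lg
    & exists2 a, a \in Pi /\ weight_dot eps a gamma != 0
               & (root_space br a <= lg)%VS].

(* W is a constituent V(nu) of the L-module A, for A a submodule of
   l (x) z(n). *)
Definition constituent (A W : {vspace tensor V}) (nu : weight h) : Prop :=
  irreducible_constituent (levi_group br levi) A W /\
  highest_weight (tens_ad br) W nu.

Definition special_constituent (mu gamma : weight h) (W : {vspace tensor V})
    (nu : weight h) : Prop :=
  [/\ constituent (tens_space levi zn) W nu, nu <> gamma
    & exists2 e, roots_in g1 e & nu = mu + e].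

End MaximalParabolic.

(* Main.v *)
Require Import Defs.
From HB Require Import structures.
From mathcomp Require Import all_boot all_order all_algebra.
From mathcomp Require Import ring zify.
Set Implicit Arguments.
Unset Strict Implicit.
Unset Printing Implicit Defensive.
Import Order.TTheory GRing.Theory Num.Theory.
Local Open Scope ring_scope.

(** The Killing form does not vanish, because on the vector of [h] dual to
    [eps_0] it is a sum of squares of integers; by simplicity it is
    nondegenerate, and every root lies in an sl_2-triple.  Root strings then
    determine the coroots on all the [eps_k].  A highest weight is therefore
    dominant for the roots [eps_p - eps_q] with [p < q <= i], which forces
    [gamma = eps_0 + eps_1] in types B and D, and [gamma = 2 eps_0] in type C.
    The centralizer in [l] of the Levi roots supported on the indices [> i] is
    an ideal meeting [l_gamma], so by simplicity it contains [l_gamma]; as these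
    roots also act trivially on [z(n)], the weight [nu] vanishes on their coroots
    and has no coordinate beyond [i].  Hence if [nu = mu + e] with [mu] and [e]
    roots of [g(1)], then [nu = eps_j + eps_k] with [j, k <= i], and dominance
    leaves only [2 eps_0] and [eps_0 + eps_1], one of which is [gamma].
    Conversely, [mu] is [eps_0] or [eps_0 +- eps_k] with [k > i], so the
    difference between the remaining candidate and [mu] is again a root of
    [g(1)]. *)

(** The hypotheses list the roots, but give neither the coroots nor the dimensions of the root
    spaces, and most lemmas live over an arbitrary [numFieldType], so eigenvectors come only from
    the eigenbases supplied by [cartan_subalgebra]. A string whose two ends are known determines the
    value of a weight on a coroot, and this recovers the missing pairings. All three types contain
    the roots [+-eps_p +- eps_q]; with a third index at hand their strings look the same in every
    type, which is where [n >= 3] enters. In type C dominance alone does not settle gamma: [2 eps_0]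
    and [eps_0 + eps_1] are both dominant roots of z(n). The second is excluded because its root
    space is a line, and so the sl_2-triples are constructed together with a bound on the root space
    of [- b]. The lower bounds on [i] leave gamma without coordinates from index [i] on, so that
    alpha_gamma is some [eps_k - eps_(k+1)] with [k < i]. The upper bounds make the
    alpha_q-coefficient the sum of the coordinates up to [i] and, in type D, provide two indices
    beyond [i]. *)

Lemma linear_lfun (F : numFieldType) (M N : vectType F) (f : M -> N) :
  linear f -> exists g : 'Hom(M, N), g =1 f.
Proof.
move=> flin; pose mixin := GRing.isLinear.Build _ _ _ _ f flin.
pose f' : {linear M -> N} := HB.pack f mixin.
by exists (linfun f') => x; rewrite lfunE.
Qed.

(** * Linear algebra: eigenvectors, traces and sl_2-strings *)

Section LinearAlgebra.
Variables (F : numFieldType) (M : vectType F).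
Implicit Types (v w : M) (f g X Y : 'End(M)).

Lemma memv_sum_ind (J : Type) (s : seq J) (p : pred J) (U : J -> {vspace M})
    (Q : M -> Prop) :
    Q 0 -> (forall u v, Q u -> Q v -> Q (u + v)) ->
    (forall j u, p j -> u \in U j -> Q u) ->
  forall v, v \in (\sum_(j <- s | p j) U j)%VS -> Q v.
Proof.
move=> Q0 QD QU; elim/big_ind: _ => [v|A B QA QB v|j pj v vU].
- by rewrite memv0 => /eqP->.
- by move/memv_addP=> [a /QA Qa [b /QB Qb ->]]; apply: QD.
- exact: QU vU.
Qed.

Lemma subv_big_seq (J : eqType) (s : seq J) (p : pred J) (U : J -> {vspace M}) j :
  j \in s -> p j -> (U j <= \sum_(k <- s | p k) U k)%VS.
Proof. by move=> js pj; rewrite (big_rem j js) pj; apply: addvSl. Qed.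

Lemma span_ind (s : seq M) (Q : M -> Prop) :
    Q 0 -> (forall u v, Q u -> Q v -> Q (u + v)) ->
    (forall c u, u \in s -> Q (c *: u)) ->
  forall v, v \in <<s>>%VS -> Q v.
Proof.
move=> Q0 QD Qs v; rewrite span_def big_seq.
apply: memv_sum_ind => // u w us /vlineP[c ->]; exact: Qs.
Qed.

Lemma coord_tnth_free m (e : m.-tuple M) (j k : 'I_m) :
  free e -> coord e k (tnth e j) = (j == k)%:R.
Proof. by move=> fe; rewrite (tnth_nth 0) coord_free. Qed.

(** The operator [f - d] kills the component of [v] in [U j], maps the other summands into
    themselves and multiplies [v] by the nonzero [c - d]; so [v] already lies in the sum of the
    others. The operator may change with [j]. *)
Lemma eigen_separated_sum (J : eqType) (s : seq J) (U : J -> {vspace M}) v :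
    (forall j, j \in s -> exists f c d, [/\ f v = c *: v, c != d,
        forall u, u \in U j -> f u = d *: u
      & forall k u, k \in s -> u \in U k -> f u \in U k]) ->
  v \in (\sum_(j <- s) U j)%VS -> v = 0.
Proof.
elim: s => [_|j s IH sep]; first by rewrite big_nil memv0 => /eqP.
rewrite big_cons => /memv_addP[a aU [b bU defv]].
have [f [c [d [fv cd fU fS]]]] := sep j (mem_head _ _).
apply: IH => [k ks|].
  have [f' [c' [d' [f'v cd' f'U f'S]]]] := sep k (mem_behead (s := j :: s) ks).
  exists f', c', d'; split=> // l u ls; apply: f'S; exact: mem_behead.
have: f v - d *: v = f b - d *: b.
  by rewrite defv linearD /= (fU _ aU) scalerDr opprD addrACA subrr add0r.
rewrite fv -scalerBl => E.
have fb : f b \in (\sum_(j0 <- s) U j0)%VS.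
  move: bU; rewrite [in X in X -> _]big_seq; move: b {defv E}.
  apply: memv_sum_ind => [|u w|k u ks uk].
  - by rewrite linear0 mem0v.
  - by rewrite linearD; apply: memvD.
  - apply: (subvP (subv_big_seq U (p := xpredT) ks isT)).
    by apply: fS => //; apply: mem_behead.
have {}E : v = (c - d)^-1 *: (f b - d *: b).
  by rewrite -E scalerA mulVf ?scale1r // subr_eq0.
by rewrite E memvZ // memvB // memvZ.
Qed.

Section Trace.
Variables (m : nat) (e : m.-tuple M) (U : {vspace M}).
Hypothesis basis_e : basis_of U e.

(** When the span of [e] is stable under [f], this is the trace of the restriction. Proper subspaces
    are allowed because a trace is later taken on eigenspaces. *)
Definition trace_on f : F := \sum_(j < m) coord e j (f e`_j).

Lemma trace_on_mulC f g :
    (forall u, u \in U -> f u \in U) -> (forall u, u \in U -> g u \in U) ->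
  trace_on (f \o g)%VF = trace_on (g \o f)%VF.
Proof.
move=> fU gU; rewrite /trace_on.
have eU j : (j < m)%N -> e`_j \in U.
  by move=> jm; apply: (basis_mem basis_e); rewrite mem_nth ?size_tuple.
have E (k1 k2 : 'End(M)) (j : 'I_m) : (forall u, u \in U -> k2 u \in U) ->
    coord e j ((k1 \o k2)%VF e`_j) =
    \sum_l coord e l (k2 e`_j) * coord e j (k1 e`_l).
  move=> kU; rewrite comp_lfunE {1}(coord_basis basis_e (kU _ (eU j (ltn_ord j)))).
  by rewrite !linear_sum; apply: eq_bigr => l _; rewrite !linearZ.
under eq_bigr do rewrite E //.
rewrite exchange_big; apply: eq_bigr => j _; rewrite E //.
by apply: eq_bigr => l _; rewrite mulrC.
Qed.

Lemma trace_on_diag f (c : 'I_m -> F) :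
  (forall j : 'I_m, f e`_j = c j *: e`_j) -> trace_on f = \sum_j c j.
Proof.
move=> fe; apply: eq_bigr => j _; rewrite fe linearZ /= coord_free ?eqxx ?mulr1 //.
exact: basis_free basis_e.
Qed.

Lemma trace_onB f g : trace_on (f - g) = trace_on f - trace_on g.
Proof.
by rewrite -sumrB; apply: eq_bigr => j _; rewrite add_lfunE opp_lfunE linearB.
Qed.

Lemma trace_onD f g : trace_on (f + g) = trace_on f + trace_on g.
Proof.
by rewrite -big_split; apply: eq_bigr => j _; rewrite add_lfunE linearD.
Qed.

Lemma trace_onZ a f : trace_on (a *: f) = a * trace_on f.
Proof.
by rewrite big_distrr; apply: eq_bigr => j _; rewrite scale_lfunE linearZ.
Qed.

End Trace.

(** The commutator has trace zero on [U], the scalar has trace [c] times the dimension of [U], and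
    the characteristic is zero. *)
Lemma scalar_commutator_eq0 (U : {vspace M}) f g (c : F) :
    (forall u, u \in U -> f u \in U) -> (forall u, u \in U -> g u \in U) ->
    (forall u, u \in U -> f (g u) - g (f u) = c *: u) ->
  U != 0%VS -> c = 0.
Proof.
move=> fU gU fg U0; have bU := vbasisP U.
have: trace_on (vbasis U) ((f \o g)%VF - (g \o f)%VF) = 0.
  by rewrite trace_onB (trace_on_mulC bU fU gU) subrr.
rewrite (trace_on_diag bU (c := fun=> c)); last first.
  move=> j; rewrite add_lfunE opp_lfunE !comp_lfunE fg //.
  by apply: vbasis_mem; rewrite mem_nth ?size_tuple.
rewrite sumr_const card_ord => /eqP; rewrite -mulr_natl mulf_eq0 pnatr_eq0.
by rewrite dimv_eq0 (negPf U0) => /eqP.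
Qed.

(* Lagrange interpolation, one factor at a time. *)
Lemma eigen_decomposition f (Q : M -> Prop) (cs : seq F) v :
    (forall a u w, Q u -> Q w -> Q (a *: u + w)) -> (forall u, Q u -> Q (f u)) ->
    uniq cs -> Q v -> foldl (fun u c => f u - c *: u) v cs = 0 ->
  exists2 us : seq M, v = \sum_(u <- us) u
    & forall u, u \in us -> Q u /\ exists2 c, c \in cs & f u = c *: u.
Proof.
move=> QL Qf.
have QZ a u : Q u -> Q (a *: u).
  move=> Qu; have Q0 : Q 0 by rewrite -(addNr u) -scaleN1r; apply: QL.
  by rewrite -[a *: u]addr0; apply: QL.
elim: cs v => [v _ _ /= ->|c cs IH v /= /andP[ccs ucs] Qv kill].
  by exists [::]; rewrite ?big_nil.
have [|us def usP] := IH (f v - c *: v) ucs _ kill.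
  by rewrite addrC -scaleNr; apply: QL => //; apply: Qf.
(* On eigenvectors with eigenvalue [d != c] the operator [f - c] is inverted by dividing by
   [d - c]. *)
have [us' def' us'P] : exists2 us' : seq M,
    f (\sum_(u <- us') u) - c *: \sum_(u <- us') u = \sum_(u <- us) u
    & forall u, u \in us' -> Q u /\ exists2 d, d \in cs & f u = d *: u.
  elim: us {def} usP => [_|u us IHu usP].
    by exists [::]; rewrite // !big_nil linear0 scaler0 subr0.
  have [Qu [d dcs fu]] := usP u (mem_head _ _).
  have [//|us' def' us'P] := IHu.
    by move=> x xus; apply: usP; apply: mem_behead.
  exists ((d - c)^-1 *: u :: us').
    rewrite !big_cons linearD linearZ /= fu scalerDr opprD addrACA def'.
    rewrite !scalerA -scalerBl [_ * d]mulrC -mulrBl mulfV ?scale1r //.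
    by rewrite subr_eq0; apply: contraNneq ccs => <-.
  move=> x; rewrite inE => /orP[/eqP->|/us'P//].
  split; first exact: QZ.
  by exists d => //; rewrite linearZ /= fu !scalerA mulrC.
have Qs : Q (\sum_(u <- us') u).
  rewrite big_seq; elim/big_ind: _ => [|u w Qu Qw|u /us'P[]//].
    by rewrite -(scale0r v); apply: QZ.
  by rewrite -[u]scale1r; apply: QL.
(* The remainder of [v] is killed by [f - c], so it is the component for the eigenvalue [c]. *)
exists (v - \sum_(u <- us') u :: us'); first by rewrite big_cons subrK.
move=> x; rewrite inE => /orP[/eqP->|/us'P[Qx [d dcs fx]]].
  split; first by rewrite addrC -scaleN1r; apply: QL.
  exists c; first exact: mem_head.
  have /(canRL (subrK _)) E := etrans def (esym def').
  by rewrite linearB scalerBr /= E [f _ + _]addrC addrAC addrK addrC.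
by split=> //; exists d; rewrite // inE dcs orbT.
Qed.

Section Sl2.
Variables (X Y T : 'End(M)) (w : M) (c : F).
Hypothesis XY : forall v, X (Y v) = Y (X v) + T v.
Hypothesis TY : forall v, T (Y v) = Y (T v) - 2 *: Y v.
Hypotheses (Xw : X w = 0) (Tw : T w = c *: w) (w_neq0 : w != 0).

Lemma sl2_weight k : T (iter k Y w) = (c - k%:R *+ 2) *: iter k Y w.
Proof.
elim: k => [|k IH]; first by rewrite mul0rn subr0.
rewrite /= TY IH linearZ -scalerBl; congr (_ *: _); ring.
Qed.

Lemma sl2_raise k :
  X (iter k.+1 Y w) = (k.+1%:R * (c - k%:R)) *: iter k Y w.
Proof.
elim: k => [|k IH]; first by rewrite /= XY Xw linear0 add0r Tw mul1r subr0.
rewrite [iter k.+2 _ _]iterS XY IH linearZ sl2_weight -iterS -scalerDl.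
congr (_ *: _); ring.
Qed.

(** The iterates of [Y] on [w] have distinct [T]-weights [c - 2k], so in finite dimension one of
    them vanishes. If [Y^(m+1) w] is the first to do so, applying [X] yields
    [(m+1)(c - m) Y^m w = 0], hence [c = m]. *)
Lemma sl2_highest_weight : exists m : nat,
  c = m%:R /\ forall k, (k <= m)%N -> iter k Y w != 0.
Proof.
have nil : exists k, iter k Y w == 0.
  set d := \dim {:M}.
  case: (boolP [exists k : 'I_d.+1, iter k Y w == 0]) => [/existsP[k kP]|].
    by exists k.
  rewrite negb_exists => /forallP nz.
  pose s N := [seq iter k Y w | k <- rev (iota 0 N)].
  have sS N : s N.+1 = iter N Y w :: s N.
    by rewrite /s -addn1 iotaD rev_cat map_cat.
  have fr N : (N <= d.+1)%N -> free (s N).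
    elim: N => [_|N IH Nd]; first exact: nil_free.
    rewrite sS free_cons IH ?(ltnW Nd) // andbT.
    apply: contraNN (nz (Ordinal Nd)) => /= /[!span_def] sv.
    apply/eqP; apply: (eigen_separated_sum _ sv) => _ /mapP[k + ->].
    rewrite mem_rev mem_iota add0n => /= kN.
    exists T, (c - N%:R *+ 2), (c - k%:R *+ 2); split.
    - exact: sl2_weight.
    - rewrite (inj_eq (addrI c)) eqr_opp -!mulrnA eqr_nat eqn_mul2r /=.
      by rewrite neq_ltn kN orbT.
    - move=> _ /vlineP[a ->]; rewrite linearZ /= sl2_weight !scalerA.
      by rewrite mulrC.
    - move=> _ _ /mapP[l _ ->] /vlineP[a ->]; rewrite linearZ /= sl2_weight.
      by rewrite scalerA memvZ // memv_line.
  have: (\dim <<s d.+1>> <= d)%N by apply: dimvS; apply: subvf.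
  rewrite (eqP (fr _ (leqnn _))) size_map size_rev size_iota ltnn //.
case: (ex_minnP nil) => -[|m]; first by rewrite /= (negPf w_neq0).
move=> /eqP m0 mmin; exists m; split; last first.
  by move=> k km; apply: contraTN km => /mmin; rewrite -ltnNge.
move: (sl2_raise m); rewrite m0 linear0 => /esym/eqP.
rewrite scaler_eq0 mulf_eq0 pnatr_eq0 /= subr_eq0 => /orP[/eqP//|/mmin].
by rewrite ltnn.
Qed.

End Sl2.
End LinearAlgebra.

(** * Lie algebras and root spaces *)

Section LieBasics.
Variables (F : numFieldType) (V : vectType F) (br : lieBracket V).

Lemma lie_brDl x y z : br (x + y) z = br x z + br y z.
Proof. by have := lie_linl br z 1 x y; rewrite !scale1r. Qed.

Lemma lie_br0l z : br 0 z = 0.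
Proof. by apply: (addrI (br 0 z)); rewrite -lie_brDl !addr0. Qed.

Lemma lie_brZl c x z : br (c *: x) z = c *: br x z.
Proof. by have := lie_linl br z c x 0; rewrite !addr0 lie_br0l addr0. Qed.

Lemma lie_brC x y : br x y = - br y x.
Proof.
apply/eqP; rewrite -addr_eq0; have := lie_alt br (x + y).
by rewrite lie_brDl !linearD /= !lie_alt add0r addr0 => ->.
Qed.

Lemma lie_brNl x z : br (- x) z = - br x z.
Proof. by rewrite -scaleN1r lie_brZl scaleN1r. Qed.

Lemma lie_leibniz x y z : br x (br y z) = br (br x y) z + br y (br x z).
Proof.
have := lie_jacobi br x y z.
rewrite (lie_brC z (br x y)) (lie_brC z x) linearN /= => /eqP.
by rewrite subr_eq0 => /eqP <-; rewrite subrK.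
Qed.

(** Of linearity in the Lie algebra element only homogeneity is recorded; it evaluates the action of
    [[t, y] = -2 y] in an sl_2-triple. *)
Definition lie_module (M : vectType F) (act : V -> M -> M) : Prop :=
  [/\ forall x, linear (act x),
      forall x y m, act (br x y) m = act x (act y m) - act y (act x m)
    & forall a x m, act (a *: x) m = a *: act x m].

Lemma adjoint_module : lie_module br.
Proof.
split=> [x|x y m|a x m]; first exact: lie_linr.
  by rewrite [in RHS]lie_leibniz addrK.
exact: lie_brZl.
Qed.

Definition centralizer (A : {vspace V}) : {vspace V} :=
  (\bigcap_(y <- vbasis A) lker (ad br y))%VS.

Lemma centralizerP (A : {vspace V}) x :
  reflect (forall y, y \in A -> br y x = 0) (x \in centralizer A).
Proof.
apply: (iffP idP) => [xC y yA|xC].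
  have {xC}xb k : k \in tval (vbasis A) -> br k x = 0.
    move: xC; rewrite /centralizer; elim: (tval (vbasis A)) => [//|j s IH].
    rewrite big_cons memv_cap memv_ker adE => /andP[/eqP xj /IH xs].
    by rewrite inE => /orP[/eqP->|/xs].
  rewrite -(span_basis (vbasisP A)) in yA; move: y yA.
  apply: span_ind => [|u v|c u /xb ux]; first exact: lie_br0l.
    by rewrite lie_brDl => -> ->; rewrite addr0.
  by rewrite lie_brZl ux scaler0.
rewrite /centralizer big_seq; elim/big_ind: _ => [|A1 A2 x1 x2|y yA].
- exact: memvf.
- by rewrite memv_cap x1.
- by rewrite memv_ker adE xC // vbasis_mem.
Qed.

Lemma mem_derived (A U : {vspace V}) :
    (forall x y, x \in A -> y \in A -> br x y \in U) ->
  (derived br A <= U)%VS.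
Proof.
move=> AU; apply/span_subvP => _ /allpairsP[[x y] [/= xA yA ->]].
by apply: AU; apply: vbasis_mem.
Qed.

(** A diagonalizable operator remains diagonalizable on a stable subspace. The subspace is a
    predicate, since it will be a common eigenspace given by conditions. *)
Lemma semisimple_decomposition (x : V) (Q : V -> Prop) v :
    ad_semisimple br x ->
    (forall a u w, Q u -> Q w -> Q (a *: u + w)) ->
    (forall u, Q u -> Q (br x u)) -> Q v ->
  exists2 us : seq V, v = \sum_(u <- us) u
    & forall u, u \in us -> Q u /\ exists c, br x u = c *: u.
Proof.
move=> [X [bX eX]] QL Qx Qv.
have [cs csP] : exists cs : seq F,
    forall y, y \in X -> exists2 c, c \in cs & br x y = c *: y.
  elim: X eX {bX} => [|y X IH] eX; first by exists [::].
  have [|cs csP] := IH; first by move=> z zX; apply: eX; rewrite inE zX orbT.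
  have [c cP] := eX y (mem_head _ _); exists (c :: cs) => z.
  rewrite inE => /orP[/eqP->|/csP[d dcs dz]].
    by exists c; rewrite ?mem_head.
  by exists d; rewrite // inE dcs orbT.
(* [k] applies the product of the factors [ad x - c]; taken over all eigenvalues it kills the
   eigenbasis, hence every vector. *)
pose k := foldl (fun u c => ad br x u - c *: u).
have kD ds u w : k (u + w) ds = k u ds + k w ds.
  by elim: ds u w => //= d ds IH u w; rewrite -IH linearD scalerDr opprD addrACA.
have k0 ds : k 0 ds = 0.
  by elim: ds => //= d ds IH; rewrite linear0 scaler0 subrr.
have kx ds y c a : br x y = c *: y -> c \in ds -> k (a *: y) ds = 0.
  move=> xy; elim: ds a => //= d ds IH a.
  rewrite adE linearZ /= xy scalerA mulrC -scalerA -scalerBl.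
  rewrite inE => /orP[/eqP->|cds]; first by rewrite subrr scale0r k0.
  by rewrite scalerA; apply: IH.
have kill u : k u (undup cs) = 0.
  have: u \in <<X>>%VS by rewrite (span_basis bX) memvf.
  move: u; apply: span_ind => [|u w ku kw|c y /csP[d dcs xy]].
  - exact: k0.
  - by rewrite kD ku kw addr0.
  - by apply: kx xy _; rewrite mem_undup.
have [|us -> usP] := eigen_decomposition QL _ (undup_uniq cs) Qv (kill v).
  by move=> u; rewrite adE; apply: Qx.
exists us => // u /usP[Qu [c _ uc]]; split=> //; exists c.
by rewrite -uc adE.
Qed.

End LieBasics.

Section Roots.
Variables (F : numFieldType) (V : vectType F) (br : lieBracket V).
Variable (h : {vspace V}).
Implicit Types (a b : weight h).
Local Notation g_ := (@root_space _ _ br h).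

(** Projecting to [h] first lets a weight be evaluated at elements of [V] such as [br x y], whose
    membership in [h] is a separate fact. *)
Definition weight_at a (x : V) : F := a (vsproj h x).

Lemma weight_atD a b x : weight_at (a + b) x = weight_at a x + weight_at b x.
Proof. by rewrite /weight_at add_lfunE. Qed.

Lemma weight_atN a x : weight_at (- a) x = - weight_at a x.
Proof. by rewrite /weight_at opp_lfunE. Qed.

Lemma weight_atZ c a x : weight_at (c *: a) x = c * weight_at a x.
Proof. by rewrite /weight_at scale_lfunE. Qed.

Lemma weight_at0 x : weight_at 0 x = 0.
Proof. by rewrite /weight_at lfunE. Qed.

Lemma mem_root_space a v :
  v \in g_ a <-> forall x, x \in h -> br x v = weight_at a x *: v.
Proof.
split=> [/root_spaceP va x xh|va].
  by rewrite -va vsprojK.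
apply/root_spaceP => H; rewrite va ?subvsP // /weight_at vsvalK //.
Qed.

Lemma lie_root_space a b x y : x \in g_ a -> y \in g_ b -> br x y \in g_ (a + b).
Proof.
move=> /mem_root_space xa /mem_root_space yb; apply/mem_root_space => z zh.
rewrite lie_leibniz xa // (yb z) // lie_brZl linearZ /= -scalerDl.
by rewrite weight_atD.
Qed.

Lemma lie_pow_root_space a b x y k :
  x \in g_ a -> y \in g_ b -> iter k (br x) y \in g_ (a *+ k + b).
Proof.
move=> xa yb; elim: k => [|k IH]; first by rewrite mulr0n add0r.
by rewrite iterS mulrS -addrA; apply: lie_root_space.
Qed.

Hypothesis cartan_h : cartan_subalgebra br h.

(** An element commuting with [h] spans together with [h] an abelian subspace, and [h] is maximal
    among these. *)
Lemma root_space0 : g_ 0 = h.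
Proof.
have [abh maxh _] := cartan_h.
have h0 : (h <= g_ 0%R)%VS.
  apply/subvP => x xh; apply/mem_root_space => y yh.
  by rewrite abh // weight_at0 scale0r.
apply/eqP; rewrite eqEsubv h0 andbT; apply/subvP => x /mem_root_space x0.
have hx y : y \in h -> br y x = 0 by move=> yh; rewrite x0 // weight_at0 scale0r.
rewrite -(maxh (h + <[x]>)%VS) ?addvSl //.
  by apply: (subvP (addvSr _ _)); apply: memv_line.
move=> _ _ /memv_addP[u uh [_ /vlineP[c ->] ->]] /memv_addP[w wh [_ /vlineP[d ->] ->]].
rewrite lie_brDl !linearD /= !lie_brZl !linearZ /= abh // hx // (lie_brC br x w) hx //.
by rewrite lie_alt oppr0 !scaler0 !addr0.
Qed.

(** Simultaneous diagonalization of [h], phrased as an induction principle because no finite list of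
    weights is available at this point. *)
Lemma root_space_decomposition v (Q : V -> Prop) :
    (forall u w, Q u -> Q w -> Q (u + w)) -> Q 0 ->
    (forall a u, u \in g_ a -> u != 0 -> Q u) ->
  Q v.
Proof.
have [abh _ ssh] := cartan_h.
move=> QD Q0 Qa.
suff joint (s : seq V) : {subset s <= h} -> exists2 us : seq V, v = \sum_(u <- us) u
    & forall u, u \in us -> forall x, x \in s -> exists c, br x u = c *: u.
  have [|us -> usP] := joint (vbasis h); first by move=> x; apply: vbasis_mem.
  rewrite big_seq; elim/big_ind: _ => // u /usP uP.
  have [->//|u0] := eqVneq u 0.
  have [c cP] : exists c : 'I_(\dim h) -> F,
      forall k : 'I_(\dim h), br (vbasis h)`_k u = c k *: u.
    apply: (fin_all_exists (P := fun (k : 'I_(\dim h)) c => br (vbasis h)`_k u = c *: u)) => k.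
    by apply: uP; rewrite mem_nth ?size_tuple.
  (* The eigenvalues of [u] on a basis of [h] extend linearly to a weight. *)
  pose f (H : subvs_of h) : F^o := \sum_k coord (vbasis h) k (vsval H) * c k.
  have flin : linear f.
    move=> d x y; rewrite /f scaler_sumr -big_split; apply: eq_bigr => k _.
    by rewrite !linearP /= mulrDl [_ *: _]mulrA.
  have [a aE] := linear_lfun flin.
  apply: (Qa a) => //; apply/root_spaceP => H.
  rewrite aE /f {1}(coord_vbasis (subvsP H)) scaler_suml.
  rewrite (big_morph (fun x => br x u) (fun x y => lie_brDl br x y u) (lie_br0l br u)).
  by apply: eq_bigr => k _; rewrite lie_brZl cP scalerA.
elim: s => [_|x s IH sh].
  by exists [:: v]; rewrite ?big_seq1.
have [|us -> usP] := IH; first by move=> y ys; apply: sh; rewrite inE ys orbT.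
have xh : x \in h by apply: sh; rewrite mem_head.
elim: us usP => [_|u us IHu usP]; first by exists [::]; rewrite ?big_nil.
have [|ws E wsP] := IHu; first by move=> w ww; apply: usP; rewrite inE ww orbT.
have [c0 cP] : exists c : V -> F, forall y, y \in s -> br y u = c y *: u.
  elim: s sh usP {IH IHu wsP} => [|y s IHs] sh usP; first by exists (fun=> 0).
  have [||c cP] := IHs.
  - by move=> z; rewrite inE => /orP[/eqP->//|zs]; apply: sh; rewrite !inE zs !orbT.
  - by move=> w /usP wP z zs; apply: wP; rewrite inE zs orbT.
  have [d dP] := usP u (mem_head _ _) y (mem_head _ _).
  exists (fun z => if z == y then d else c z) => z; rewrite inE.
  by case: eqVneq => [->//|_ /= /cP].
(* Since [h] is abelian, [br x] preserves the common eigenspace of the vectors in [s], so [u] can be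
   split further inside it. *)
pose Qu w := forall y, y \in s -> br y w = c0 y *: w.
have [|||ws' E' ws'P] := @semisimple_decomposition _ _ br x Qu u (ssh x xh).
- by move=> a w1 w2 h1 h2 y ys; rewrite linearP /= h1 // h2 // scalerDr !scalerA mulrC.
- move=> w hw y ys; have yh : y \in h by apply: sh; rewrite inE ys orbT.
  by rewrite lie_leibniz (hw y) // linearZ /= (abh y x) // lie_br0l add0r.
- exact: cP.
exists (ws' ++ ws); first by rewrite big_cat big_cons /= E -E'.
move=> w; rewrite mem_cat => /orP[/ws'P[Qw [c xw]] y|/wsP//].
rewrite inE => /orP[/eqP->|ys]; first by exists c.
by exists (c0 y); apply: Qw.
Qed.

End Roots.

(** * sl_2-triples and root strings *)

Section Sl2Triples.
Variables (F : numFieldType) (V : vectType F) (br : lieBracket V).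
Variable (h : {vspace V}).
Local Notation g_ := (@root_space _ _ br h).

(** The relations [[t, x] = 2 x] and [[t, y] = -2 y] for [t = [x, y]] follow once [t] is known to
    lie in [h], the root space of 0. *)
Definition sl2_triple (b : weight h) (x y : V) : Prop :=
  [/\ x \in g_ b, y \in g_ (- b) & weight_at b (br x y) = 2].

Lemma sl2_triple_sym b x y : sl2_triple b x y -> sl2_triple (- b) y x.
Proof.
move=> [xb yb b2]; split; rewrite ?opprK //.
by rewrite lie_brC weight_atN /weight_at !linearN /= opprK.
Qed.

Lemma weight_ext (a b : weight h) :
  (forall x, x \in h -> weight_at a x = weight_at b x) -> a = b.
Proof.
move=> ab; apply/lfunP => H; have := ab _ (subvsP H).
by rewrite /weight_at vsvalK.
Qed.

Hypothesis cartan_h : cartan_subalgebra br h.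

Lemma sl2_triple_cartan b x y : sl2_triple b x y -> br x y \in h.
Proof.
by move=> [xb yb _]; rewrite -(root_space0 cartan_h) -(subrr b) lie_root_space.
Qed.

Lemma sl2_module_highest_weight (M : vectType F) (act : V -> M -> M) b x y w c :
    lie_module br act -> sl2_triple b x y ->
    act x w = 0 -> act (br x y) w = c *: w -> w != 0 ->
  exists m : nat, c = m%:R /\ forall k, (k <= m)%N -> iter k (act y) w != 0.
Proof.
move=> [actL actB actZ] t3 xw tw w0; have th := sl2_triple_cartan t3.
have [xb /mem_root_space yb b2] := t3.
have [X XE] := linear_lfun (actL x).
have [Y YE] := linear_lfun (actL y).
have [D DE] := linear_lfun (actL (br x y)).
have [v||||m [cm mP]] := @sl2_highest_weight _ _ X Y D w c _ _ _ _ w0.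
- by rewrite !XE !YE !DE actB addrC subrK.
- move=> v; rewrite !YE !DE.
  have := actB (br x y) y v; rewrite yb // weight_atN b2 actZ scaleNr.
  by move/(canLR (subrK _)) <-; rewrite addrC.
- by rewrite XE.
- by rewrite DE.
by exists m; split=> // k /mP; rewrite (eq_iter YE).
Qed.

Lemma sl2_adjoint_highest_weight b x y w c :
    sl2_triple b x y -> br x w = 0 -> br (br x y) w = c *: w -> w != 0 ->
  exists m : nat, c = m%:R /\ forall k, (k <= m)%N -> iter k (br y) w != 0.
Proof. exact: sl2_module_highest_weight (adjoint_module br). Qed.

Lemma sl2_lowest_weight b x y w c :
    sl2_triple b x y -> br y w = 0 -> br (br x y) w = - c *: w -> w != 0 ->
  exists m : nat, c = m%:R /\ forall k, (k <= m)%N -> iter k (br x) w != 0.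
Proof.
move=> /sl2_triple_sym t3 yw tw; apply: (sl2_adjoint_highest_weight t3 yw).
by rewrite (lie_brC br y x) lie_brNl tw scaleNr opprK.
Qed.

(** A vector at the top of the string has highest weight [m = a(t) + 2q], and its [m] nonzero
    descendants cannot pass the bottom, so [m <= p + q]. Likewise a bottom vector gives
    [l = 2p - a(t) <= p + q]. As [m + l = 2(p + q)], both bounds are equalities. Nothing is assumed
    about the inside of the string. *)
Lemma root_string b x y a (p q : nat) :
    sl2_triple b x y ->
    g_ (a + b *+ q) != 0%VS -> g_ (a - b *+ p) != 0%VS ->
    g_ (a + b *+ q.+1) = 0%VS -> g_ (a - b *+ p.+1) = 0%VS ->
  weight_at a (br x y) = p%:R - q%:R.
Proof.
move=> t3 top bot above below; have th := sl2_triple_cartan t3.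
have [xb yb b2] := t3; set t := br x y.
have atn k : weight_at (b *+ k) t = 2 * k%:R.
  by rewrite -scaler_nat weight_atZ b2 mulrC.
have [w wt w0] : exists2 w, w \in g_ (a + b *+ q) & w != 0.
  by exists (vpick (g_ (a + b *+ q))); rewrite ?memv_pick ?vpick0.
have [u ub u0] : exists2 u, u \in g_ (a - b *+ p) & u != 0.
  by exists (vpick (g_ (a - b *+ p))); rewrite ?memv_pick ?vpick0.
have xw : br x w = 0.
  apply/eqP; rewrite -memv0 -above mulrS addrCA; exact: lie_root_space.
have yu : br y u = 0.
  apply/eqP; rewrite -memv0 -below mulrS opprD addrCA; exact: lie_root_space.
have [|m [mE mP]] := sl2_adjoint_highest_weight (c := weight_at a t + 2 * q%:R)
    t3 xw _ w0.
  by move/mem_root_space: wt => /(_ _ th) ->; rewrite weight_atD atn.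
have [|l [lE lP]] := sl2_lowest_weight (c := 2 * p%:R - weight_at a t)
    t3 yu _ u0.
  move/mem_root_space: ub => /(_ _ th) ->; rewrite weight_atD weight_atN atn.
  by rewrite opprB.
have le_m : (m <= p + q)%N.
  rewrite leqNgt; apply/negP => /mP/eqP; apply; apply/eqP.
  rewrite -memv0 -below; have := lie_pow_root_space (p + q).+1 yb wt.
  by rewrite -addSn mulNrn mulrnDr opprD [a + _]addrC addrA subrK addrC.
have le_l : (l <= p + q)%N.
  rewrite leqNgt; apply/negP => /lP/eqP; apply; apply/eqP.
  rewrite -memv0 -above; have := lie_pow_root_space (p + q).+1 xb ub.
  by rewrite addnC -addSn mulrnDr [a + _]addrC addrA addrK addrC.
have : (m + l)%:R = (2 * (p + q))%:R :> F.
  by rewrite natrD -mE -lE natrM natrD; ring.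
move/eqP; rewrite eqr_nat => /eqP ml.
have -> : weight_at a t = m%:R - 2 * q%:R by rewrite -mE addrK.
have -> : m = (p + q)%N by lia.
rewrite natrD; ring.
Qed.

End Sl2Triples.

(** * The classical root systems *)

Section RootSystem.
Variables (F : numFieldType) (V : vectType F) (h : {vspace V}).
Variables (T : classicalType) (n : nat) (eps : n.-tuple (weight h)).
Hypothesis basis_eps : basis_of fullv eps.
Local Notation e := (tnth eps).
Local Notation Delta := (root_system T eps).
Implicit Types (a : weight h) (j k p q : 'I_n) (s : bool).

Lemma coord_eps j k : coord eps k (e j) = (j == k)%:R.
Proof. exact: coord_tnth_free (basis_free basis_eps). Qed.

Lemma weight_coordE a : a = \sum_k coord eps k a *: e k.
Proof.
rewrite {1}(coord_basis basis_eps (memvf a)).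
by apply: eq_bigr => k _; rewrite (tnth_nth 0).
Qed.

Lemma coord_inj a b : (forall k, coord eps k a = coord eps k b) -> a = b.
Proof.
move=> ab; rewrite (weight_coordE a) (weight_coordE b).
by apply: eq_bigr => k _; rewrite ab.
Qed.

Lemma weight_at_coord a x :
  weight_at a x = \sum_k coord eps k a * weight_at (e k) x.
Proof.
rewrite {1}(weight_coordE a) /weight_at sum_lfunE.
by apply: eq_bigr => k _; rewrite scale_lfunE.
Qed.

Variant root_spec a : Prop :=
| RootPair p q s s' of p != q & a = (-1) ^+ s *: e p + (-1) ^+ s' *: e q
| RootShort p s of T = TypeB & a = (-1) ^+ s *: e p
| RootLong p s of T = TypeC & a = (-1) ^+ s *: (e p *+ 2).

Lemma root_systemP a : a \in Delta -> root_spec a.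
Proof.
rewrite mem_cat => /orP[/allpairsP[[[p q] [s s']]]|].
  rewrite /= mem_enum inE /= => -[pq ss ->].
  have {}pq : p != q by rewrite -val_eqE neq_ltn pq.
  case/or4P: ss => [||/eqP|/orP[/eqP|]//].
  - by move/eqP=> [-> ->]; apply: (@RootPair _ p q false false).
  - by move/eqP=> [-> ->]; apply: (@RootPair _ p q false true).
  - by case=> -> ->; apply: (@RootPair _ p q true false).
  - by case=> -> ->; apply: (@RootPair _ p q true true).
case E: T => // /allpairsP[[p s]] /= [_ + ->]; rewrite !inE => /orP[]/eqP->.
- exact: (@RootShort _ p false).
- exact: (@RootShort _ p true).
- exact: (@RootLong _ p false).
- exact: (@RootLong _ p true).
Qed.

Lemma mem_root_pair p q s s' :
  p != q -> (-1) ^+ s *: e p + (-1) ^+ s' *: e q \in Delta.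
Proof.
suff H p' q' s1 s2 : (p' < q')%N -> (-1) ^+ s1 *: e p' + (-1) ^+ s2 *: e q' \in Delta.
  rewrite -val_eqE neq_ltn => /orP[|qp]; first exact: H.
  by rewrite addrC; apply: H.
move=> pq; rewrite mem_cat; apply/orP; left; apply/allpairsP.
exists (p', q', ((-1) ^+ s1, (-1) ^+ s2)); split; rewrite ?mem_enum ?inE //=.
by case: s1; case: s2; rewrite ?eqxx ?orbT.
Qed.

Lemma mem_root_short p s : T = TypeB -> (-1) ^+ s *: e p \in Delta.
Proof.
move=> TB; rewrite /root_system TB mem_cat; apply/orP; right; apply/allpairsP.
by exists (p, (-1) ^+ s); split; rewrite ?mem_enum //; case: s; rewrite !inE eqxx ?orbT.
Qed.

Lemma mem_root_long p s : T = TypeC -> (-1) ^+ s *: (e p *+ 2) \in Delta.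
Proof.
move=> TC; rewrite /root_system TC mem_cat; apply/orP; right; apply/allpairsP.
by exists (p, (-1) ^+ s); split; rewrite ?mem_enum //; case: s; rewrite !inE eqxx ?orbT.
Qed.

Lemma coord_root_real a k : a \in Delta -> coord eps k a \is Num.real.
Proof.
have sgn s : (-1) ^+ s \is @Num.real F by case: s; rewrite ?rpredN rpred1.
have nat (b : bool) : b%:R \is @Num.real F by apply: rpred_nat.
move/root_systemP; case=> [p q s s' _|p s _|p s _] ->;
  rewrite ?linearD !linearZ ?linearMn /= ?coord_eps.
- by apply: rpredD; apply: rpredM.
- exact: rpredM.
- by apply: rpredD; apply: rpredM.
Qed.

(** A coordinate of modulus at least 2 occurs only in the long roots [+-2 eps_p] of type C. Squaring
    disposes of the sign. *)
Lemma root_large_coord a p q :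
  a \in Delta -> p != q -> 4 <= coord eps p a ^+ 2 -> coord eps q a = 0.
Proof.
move=> + pq; move/root_systemP; case=> [p' q' s s' pq'|p' s _|p' s _] ->;
  rewrite ?linearD !linearZ ?linearMn /= ?coord_eps.
- have [<-|pp] := eqVneq p' p.
    rewrite eq_sym (negPf pq') mulr0 addr0 mulr1 sqrr_sign => H; exfalso.
    by move: H; rewrite lern1.
  rewrite mulr0 add0r; case: (q' == p); rewrite ?mulr1 ?mulr0 ?sqrr_sign.
    by rewrite lern1.
  by rewrite expr0n /= lern0.
- by case: (p' == p); rewrite ?mulr1 ?mulr0 ?sqrr_sign ?lern1 // expr0n lern0.
- have [->|pp] := eqVneq p' p; first by rewrite (negPf pq) mulr0 addr0.
  by rewrite mulr0 addr0 expr0n lern0.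
Qed.

Lemma root_three_coords a j k l :
    a \in Delta -> j != k -> j != l -> k != l ->
  [|| coord eps j a == 0, coord eps k a == 0 | coord eps l a == 0].
Proof.
move=> + jk jl kl; move/root_systemP; case=> [p q s s' pq|p s _|p s _] ->;
  rewrite ?linearD !linearZ ?linearMn /= ?coord_eps.
- have [E|] := eqVneq p j; have [E'|] := eqVneq p k; have [E''|] := eqVneq p l;
  have [G|] := eqVneq q j; have [G'|] := eqVneq q k; have [G''|] := eqVneq q l;
  subst; rewrite ?mulr0 ?addr0 ?eqxx ?orbT //; move: jk jl kl pq;
  by rewrite ?eqxx.
- have [E|] := eqVneq p j; have [E'|] := eqVneq p k;
  subst; rewrite ?mulr0 ?eqxx ?orbT //; move: jk; by rewrite ?eqxx.
- have [E|] := eqVneq p j; have [E'|] := eqVneq p k;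
  subst; rewrite ?mulr0 ?addr0 ?eqxx ?orbT //; move: jk; by rewrite ?eqxx.
Qed.

(** Evaluating all [e j] embeds [h] into [F^n], and the two dimensions agree, so the unit vectors
    are attained. *)
Lemma dual_eps k :
  exists2 x, x \in h & forall j, weight_at (e j) x = (j == k)%:R.
Proof.
pose f (H : subvs_of h) : 'rV[F]_n := \row_j (e j H : F).
have flin : linear f.
  by move=> c x y; apply/rowP => j; rewrite !mxE linearP.
have [g gE] := linear_lfun flin.
have g0 : (fullv :&: lker g)%VS = 0%VS.
  apply/eqP; rewrite -subv0; apply/subvP => H; rewrite memv_cap memv_ker memv0 gE.
  case/andP=> _ /eqP/rowP fH.
  have aH (a : weight h) : a H = 0.
    rewrite (weight_coordE a) sum_lfunE big1 // => j _.
    by have := fH j; rewrite !mxE scale_lfunE => ->; rewrite scaler0.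
  rewrite (coord_vbasis (memvf H)) big1 // => j _.
  (* Coordinate functionals on [h] are themselves weights, so a vector killed by all weights is
     zero. *)
  have clin : linear (coord (vbasis {:subvs_of h}) j : _ -> F^o).
    by move=> c x y; rewrite linearP.
  by have [c cE] := linear_lfun clin; rewrite -[coord _ _ _]cE aH scale0r.
have : limg g = fullv.
  apply/eqP; rewrite eqEdim subvf (limg_dim_eq g0) !dimvf dim_matrix mul1r.
  have dual : \dim {:weight h} = (dim (subvs_of h) * 1)%N by rewrite dimvf.
  by have := size_basis basis_eps; rewrite dual muln1 => E; rewrite -[leqLHS]E; apply: leqnn.
move=> gfull; have : delta_mx 0 k \in limg g by rewrite gfull memvf.
case/memv_imgP => H _ /rowP E; exists (vsval H); first exact: subvsP.
by move=> j; have := E j; rewrite gE !mxE /weight_at vsvalK eqxx eq_sym.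
Qed.

End RootSystem.

(** * The Killing form, sl_2-triples and coroots *)

Section StandardLie.
Variables (F : numFieldType) (V : vectType F) (br : lieBracket V).
Variables (h : {vspace V}) (T : classicalType) (n : nat).
Variable eps : n.-tuple (weight h).
Hypothesis std : standard_realization br T eps.
Hypothesis n_ge3 : (2 < n)%N.
Local Notation e := (tnth eps).
Local Notation Delta := (root_system T eps).
Local Notation g_ := (@root_space _ _ br h).

Let simple_V : simple_lie br fullv. Proof. by case: std. Qed.
Let cartan_h : cartan_subalgebra br h. Proof. by case: std. Qed.
Let basis_eps : basis_of fullv eps. Proof. by case: std. Qed.

Lemma is_rootE (a : weight h) : is_root br a <-> a \in Delta.
Proof. by case: std. Qed.

Lemma root_neq0 a : a \in Delta -> a != 0.
Proof. by move/is_rootE=> []. Qed.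

Lemma root_space_neq0 a : a \in Delta -> g_ a != 0%VS.
Proof. by move/is_rootE=> []. Qed.

Lemma root_space_eq0 a : a != 0 -> a \notin Delta -> g_ a = 0%VS.
Proof.
move=> a0; apply: contraNeq => ga; apply/is_rootE; split=> //.
Qed.

Lemma root_vector a : a \in Delta -> exists2 x, x \in g_ a & x != 0.
Proof.
by move/root_space_neq0; exists (vpick (g_ a)); rewrite ?memv_pick ?vpick0.
Qed.

Lemma sum_root_spaces : (\sum_(a <- 0%R :: Delta) g_ a)%VS = fullv.
Proof.
apply/eqP; rewrite eqEsubv subvf; apply/subvP => v _.
apply: (@root_space_decomposition _ _ _ _ cartan_h v (fun v => v \in _)) => [u w||a u ua u0].
- exact: memvD.
- exact: mem0v.
- apply: (subvP (subv_big_seq _ (p := xpredT) (j := a) _ isT)) => //.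
  rewrite inE; have [//|a0 /=] := eqVneq a 0; apply/is_rootE; split=> //.
  by apply: contraNneq u0 => ga; rewrite ga memv0 in ua.
Qed.

Lemma center_eq0 z : (forall x, br x z = 0) -> z = 0.
Proof.
move=> zC; have [[x [y [_ _ xy]]] simpleI] := simple_V.
have: z \in centralizer br fullv by apply/centralizerP.
case: (simpleI (centralizer br fullv)) => [|->|E].
- split; first exact: subvf.
  move=> u w _ /centralizerP wC; apply/centralizerP => v _.
  by rewrite (wC u) ?memvf // linear0.
- by rewrite memv0 => /eqP.
- have /centralizerP/(_ x (memvf _)) : y \in centralizer br fullv by rewrite E memvf.
  by move/eqP; rewrite (negPf xy).
Qed.

(* The trace is taken in an eigenbasis of the vector dual to [eps_0]; since the
   roots are given, Cartan's criterion is not needed. *)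
Lemma nondegenerate_invariant_form : exists K : V -> V -> F,
  [/\ forall c x y z, K (c *: x + y) z = c * K x z + K y z,
      forall x y, K x y = K y x,
      forall x y z, K (br x y) z = K x (br y z)
    & forall x, (forall y, K x y = 0) -> x = 0].
Proof.
have [_ _ ssh] := cartan_h.
pose i0 : 'I_n := Ordinal (ltnW (ltnW n_ge3)).
pose i1 : 'I_n := Ordinal (ltnW n_ge3).
have [H Hh Heps] := dual_eps basis_eps i0.
have [X [bX eX]] := ssh H Hh.
have HE a : weight_at a H = coord eps i0 a.
  rewrite (weight_at_coord basis_eps) (bigD1 i0) //= big1 => [|k ki].
    by rewrite Heps eqxx mulr1 addr0.
  by rewrite Heps (negPf ki) mulr0.
pose K x y := trace_on (in_tuple X) (ad br x \o ad br y)%VF.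
have KL c x y z : K (c *: x + y) z = c * K x z + K y z.
  rewrite /K -trace_onZ -trace_onD; congr trace_on; apply/lfunP => v.
  by rewrite add_lfunE scale_lfunE !comp_lfunE !adE lie_brDl lie_brZl.
have tr (f g : 'End(V)) :
    trace_on (in_tuple X) (f \o g)%VF = trace_on (in_tuple X) (g \o f)%VF.
  by apply: (trace_on_mulC (U := fullv)) => // u _; apply: memvf.
have adB x y : ad br (br x y) = (ad br x \o ad br y)%VF - (ad br y \o ad br x)%VF.
  apply/lfunP => v; rewrite add_lfunE opp_lfunE !comp_lfunE !adE.
  by rewrite [in RHS]lie_leibniz addrK.
have KI x y z : K (br x y) z = K x (br y z).
  rewrite /K !adB comp_lfunDl comp_lfunDr comp_lfunNl comp_lfunNr !trace_onB.
  rewrite -!comp_lfunA; congr (_ - _).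
  by rewrite tr -!comp_lfunA.
have KC x y : K x y = K y x by rewrite /K tr.
exists K; split=> //.
have [c cP] : exists c : 'I_(size X) -> F, forall k : 'I_(size X), br H X`_k = c k *: X`_k.
  apply: (fin_all_exists (P := fun (k : 'I_(size X)) c => br H X`_k = c *: X`_k)).
  by move=> k; apply: eX; rewrite mem_nth.
(* An eigenvector with a non-real eigenvalue would be separated by [ad H] from every root space,
   where [H] acts by a real coordinate. *)
have creal k : c k \is Num.real.
  have X0 : X`_k != 0.
    by apply: (basis_not0 bX); rewrite mem_nth.
  have [//|ck] := boolP (c k \is Num.real).
  suff Xk0 : X`_k = 0 by rewrite Xk0 eqxx in X0.
  apply: (eigen_separated_sum (s := 0 :: Delta) (U := g_)); last first.
    by rewrite sum_root_spaces memvf.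
  move=> a aD; exists (ad br H), (c k), (weight_at a H).
  split.
  - by rewrite adE cP.
  - apply: contraNneq ck => ->; rewrite HE; move: aD; rewrite inE.
    case/orP=> [/eqP->|]; first by rewrite linear0 rpred0.
    exact: coord_root_real.
  - by move=> u /mem_root_space; rewrite adE; apply.
  - by move=> b u _ ub; rewrite adE; move/mem_root_space: (ub) => -> //; apply: memvZ.
have KHH : K H H != 0.
  rewrite /K (@trace_on_diag _ _ _ (in_tuple X) fullv bX _ (fun k => c k ^+ 2)); last first.
    by move=> k; rewrite comp_lfunE !adE cP linearZ /= cP scalerA.
  rewrite psumr_neq0; last by move=> k _; apply: real_exprn_even_ge0.
  (* [H] acts by 1 on the root space of [eps_0 + eps_1], so the eigenvalues [c k] are not all
     zero. *)
  have rD : (-1) ^+ false *: e i0 + (-1) ^+ false *: e i1 \in Delta.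
    exact: mem_root_pair.
  have [x /mem_root_space/(_ H Hh) xa x0] := root_vector rD.
  apply/hasP; apply/hasP; apply: contraT; rewrite -all_predC => /allP c0.
  have adH0 v : br H v = 0.
    rewrite (coord_basis (X := in_tuple X) bX (memvf v)) linear_sum big1 // => k _.
    rewrite linearZ /= cP; have := c0 k (mem_index_enum _).
    rewrite /= -real_leNgt ?rpred0 ?rpredX // => ck.
    have : c k ^+ 2 == 0 by rewrite eq_le ck real_exprn_even_ge0.
    by rewrite expf_eq0 /= => /eqP->; rewrite scale0r scaler0.
  move: xa; rewrite adH0 HE linearD !linearZ /= !coord_eps //.
  move/esym/eqP; rewrite scaler_eq0 (negPf x0) orbF eqxx /=.
  by rewrite !mul1r addr0 oner_eq0.
have flin : linear ((fun x => \row_k K x (vbasis {:V})`_k) : V -> 'rV[F]_(\dim {:V})).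
  by move=> a x y; apply/rowP => k; rewrite !mxE KL.
have [f fE] := linear_lfun flin.
have KZr a x y z : K z (a *: x + y) = a * K z x + K z y by rewrite !(KC z) KL.
have K0 x : K x 0 = 0 by have := KZr (-1) 0 0 x; rewrite scaler0 addr0 mulN1r addNr.
have radP x : x \in lker f <-> forall y, K x y = 0.
  rewrite memv_ker fE; split=> [/eqP/rowP xK y|xK]; last first.
    by apply/eqP/rowP => k; rewrite !mxE.
  rewrite (coord_vbasis (memvf y)); elim/big_ind: _ => // [u w uK wK|k _].
    by rewrite -[u]scale1r KZr uK wK mulr0 addr0.
  by have := xK k; rewrite !mxE -[_ *: _]addr0 KZr K0 => ->; rewrite mulr0 addr0.
(* The kernel of [f] is the radical of [K]. Invariance makes it an ideal, and it is not everything
   because [K H H != 0]. *)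
have [_ /(_ (lker f))[|E|E]] := simple_V.
- split; first exact: subvf.
  move=> x y _ /radP yK; apply/radP => z.
  by rewrite lie_brC -scaleN1r -[_ *: _]addr0 KL KI yK mulr0 add0r KC K0.
- by move=> x xK; have := proj2 (radP x) xK; rewrite E memv0 => /eqP.
- by case/eqP: KHH; apply: (proj1 (radP H)); rewrite E memvf.
Qed.

(** The second conclusion bounds the root space of [- b] by a line; it is what later decides gamma
    in type C. *)
Lemma exists_sl2_triple b : b \in Delta ->
  exists x y, sl2_triple br b x y /\ (g_ (- b) <= <[y]>)%VS.
Proof.
move=> bD; have [K [KL KC KI Knd]] := nondegenerate_invariant_form.
have KZ c x z : K (c *: x) z = c * K x z.
  have K0 : K 0 z = 0 by have := KL (-1) z z z; rewrite scaleN1r mulN1r !addNr.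
  by rewrite -[c *: x]addr0 KL K0 addr0.
have KD x y z : K (x + y) z = K x z + K y z.
  by rewrite -[x]scale1r KL mul1r scale1r.
(* Invariance moves [H] from one argument to the other, giving [(a + c)(H) K x y = 0]. *)
have orth a c x y : x \in g_ a -> y \in g_ c -> a + c != 0 -> K x y = 0.
  move=> /mem_root_space xa /mem_root_space yc; apply: contraNeq => Kxy.
  apply/eqP/weight_ext => H Hh; apply: (mulIf Kxy).
  rewrite weight_at0 mul0r weight_atD mulrDl.
  rewrite -KZ -xa // lie_brC -scaleN1r KZ KI yc // KC KZ KC; ring.
have full x : (forall a y, y \in g_ a -> K x y = 0) -> x = 0.
  move=> xK; apply: Knd => y.
  apply: (@root_space_decomposition _ _ _ _ cartan_h y (fun y => K x y = 0)).
  - by move=> u w; rewrite ![K x _]KC KD => -> ->; rewrite addr0.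
  - by rewrite KC -(scale0r x) KZ mul0r.
  - by move=> a u /xK.
have [x xb x0] := root_vector bD.
have [y yb Kxy] : exists2 y, y \in g_ (- b) & K x y != 0.
  case: (boolP (has (fun y => K x y != 0) (vbasis (g_ (- b))))) => [/hasP[y yB]|].
    by exists y; rewrite ?vbasis_mem.
  rewrite -all_predC => /allP K0.
  suff x00 : x = 0 by rewrite x00 eqxx in x0.
  apply: full => a y ya; have [ab|] := eqVneq (b + a) 0; last exact: orth.
  move: ya; have -> : a = - b by apply/eqP; rewrite -addr_eq0 addrC ab.
  rewrite -{1}(span_basis (vbasisP (g_ (- b)))); move: y.
  apply: span_ind => [|u w|c u uB].
  - by rewrite KC -(scale0r x) KZ mul0r.
  - by rewrite ![K x _]KC KD => -> ->; rewrite addr0.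
  - by rewrite KC KZ KC; have := K0 u uB; rewrite /= negbK => /eqP->; rewrite mulr0.
have th : br x y \in h by rewrite -(root_space0 cartan_h) -(subrr b) lie_root_space.
set t := br x y in th.
have [_ _ ssh] := cartan_h.
(* Otherwise [t] commutes with [x] and [y], and on each eigenspace of [ad t] the eigenvalue is the
   commutator of [ad x] and [ad y], hence zero by the trace. Then [t] is central, so zero, against
   [K H t = b(H) K x y] with [b] nonzero. *)
have bt0 : weight_at b t != 0.
  apply/eqP => bt0.
  have tx : br t x = 0.
    by move/mem_root_space: xb => -> //; rewrite bt0 scale0r.
  have ty : br t y = 0.
    by move/mem_root_space: yb => -> //; rewrite weight_atN bt0 oppr0 scale0r.
  have [X [bX eX]] := ssh t th.
  have adt v : br t v = 0.
    have: v \in <<X>>%VS by rewrite (span_basis bX) memvf.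
    move: v; apply: span_ind => [|u w|c u uX]; first exact: linear0.
      by rewrite linearD /= => -> ->; rewrite addr0.
    have [d tu] := eX u uX.
    have EP v : v \in lker (ad br t - d *: \1%VF) <-> br t v = d *: v.
      rewrite memv_ker add_lfunE opp_lfunE scale_lfunE id_lfunE adE subr_eq0.
      by split=> /eqP.
    suff d0 : d = 0 by rewrite linearZ /= tu d0 scale0r scaler0.
    apply: (scalar_commutator_eq0 (U := lker (ad br t - d *: \1%VF))
              (f := ad br x) (g := ad br y)).
    - move=> v /EP tv; apply/EP.
      by rewrite adE lie_leibniz tx lie_br0l add0r tv linearZ.
    - move=> v /EP tv; apply/EP.
      by rewrite adE lie_leibniz ty lie_br0l add0r tv linearZ.
    - by move=> v /EP tv; rewrite !adE lie_leibniz addrK.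
    - apply: contraTneq (basis_not0 bX uX) => E0; rewrite negbK -memv0 -E0.
      exact/EP.
  have t0 : t = 0 by apply: center_eq0 => v; rewrite lie_brC adt oppr0.
  case/eqP: (root_neq0 bD); apply: weight_ext => H Hh; apply: (mulIf Kxy).
  rewrite weight_at0 mul0r -KZ.
  move/mem_root_space: (xb) => /(_ H Hh) <-.
  by rewrite KI -/t t0 KC -(scale0r x) KZ mul0r.
pose y' := (2 / weight_at b t) *: y.
have t3 : sl2_triple br b x y'.
  split=> //; first exact: memvZ.
  rewrite linearZ /= -/t /weight_at !linearZ /= -[X in _ *: X]/(weight_at b t).
  by rewrite [_ *: _]mulrAC mulfK.
exists x, y'; split=> //; apply/subvP => v vb.
have Kxy' : K x y' != 0.
  by rewrite KC KZ KC mulf_neq0 // mulf_neq0 ?invr_eq0 // pnatr_eq0.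
pose v' := v - (K x v / K x y') *: y'.
have yb' : y' \in g_ (- b) by case: t3.
have vb' : v' \in g_ (- b) by rewrite memvB // memvZ.
have Kv' : K x v' = 0.
  rewrite /v' KC KD -scaleNr KZ ![K _ x]KC mulNr divfK ?subrr //.
(* [br x v'] lies in [h], and its pairing with [z] in [h] is [b(z) K x v' = 0]; so it is orthogonal
   to everything. *)
have xv : br x v' = 0.
  apply: full => a z za; have [a0|a0] := eqVneq a 0.
    move: za; rewrite a0 (root_space0 cartan_h) => zh.
    rewrite KC -KI; move/mem_root_space: (xb) => /(_ z zh) ->.
    by rewrite KZ Kv' mulr0.
  apply: (orth 0 a) => //; last by rewrite add0r.
  by rewrite -(subrr b); apply: lie_root_space.
apply/vlineP; exists (K x v / K x y'); apply/eqP; rewrite -subr_eq0 -/v'.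
apply: contraT => v0.
(* A nonzero [v'] would be a highest weight vector of weight -2, which is not a natural number. *)
have [|m [mE _]] := sl2_adjoint_highest_weight (c := - 2) cartan_h t3 xv _ v0.
  move/mem_root_space: vb' => -> //; last exact: (sl2_triple_cartan cartan_h t3).
  by rewrite weight_atN; case: t3 => _ _ ->.
have: (m + 2)%:R = 0 :> F by rewrite natrD -mE addNr.
by move/eqP; rewrite pnatr_eq0 addn2.
Qed.

Lemma root_string_weight b x y a (p q : nat) :
    sl2_triple br b x y ->
    a + b *+ q \in Delta -> a - b *+ p \in Delta ->
    a + b *+ q.+1 \notin 0 :: Delta -> a - b *+ p.+1 \notin 0 :: Delta ->
  weight_at a (br x y) = p%:R - q%:R.
Proof.
rewrite !inE !negb_or => t3 top bot /andP[? ?] /andP[? ?].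
apply: (root_string cartan_h t3); rewrite ?root_space_neq0 ?root_space_eq0 //.
Qed.

Lemma notin_roots a p q :
    p != q -> 4 <= coord eps p a ^+ 2 -> coord eps q a != 0 -> a \notin 0 :: Delta.
Proof.
move=> pq ap; apply: contraNN; rewrite inE => /orP[/eqP->|aD].
  by rewrite linear0.
by rewrite (root_large_coord basis_eps aD pq ap).
Qed.

End StandardLie.

Section Coroots.
Variables (F : numFieldType) (V : vectType F) (br : lieBracket V).
Variables (h : {vspace V}) (T : classicalType) (n : nat).
Variable eps : n.-tuple (weight h).
Hypothesis std : standard_realization br T eps.
Hypothesis n_ge3 : (2 < n)%N.
Local Notation e := (tnth eps).
Local Notation Delta := (root_system T eps).
Local Notation g_ := (@root_space _ _ br h).

Let basis_eps : basis_of fullv eps. Proof. by case: std. Qed.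

(** The coroot is found by testing it on roots [+-e p +- e c] with a third index [c], so the
    argument does not depend on the type. *)
Lemma weight_at_root_pair (p q : 'I_n) (s s' : bool) x y nu : p != q ->
    sl2_triple br ((-1) ^+ s *: e p + (-1) ^+ s' *: e q) x y ->
  weight_at nu (br x y) =
    (-1) ^+ s * coord eps p nu + (-1) ^+ s' * coord eps q nu.
Proof.
have cE := coord_eps basis_eps.
(* For [a = +-e p1 +- e c] sharing its first term with [b], the string is [a - b], [a]: [a + b] and
   [a - 2b] have a coordinate [+-2] next to another nonzero one. Taking both signs of [e c] then
   separates the two values. *)
have string p1 q1 (s1 s2 : bool) x1 y1 c (r : bool) :
    p1 != q1 -> c != p1 -> c != q1 ->
    sl2_triple br ((-1) ^+ s1 *: e p1 + (-1) ^+ s2 *: e q1) x1 y1 ->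
    (-1) ^+ s1 * weight_at (e p1) (br x1 y1) +
    (-1) ^+ r * weight_at (e c) (br x1 y1) = 1.
  move=> pq cp cq t3; rewrite -!weight_atZ -weight_atD.
  transitivity (1%:R - 0%:R : F); last by rewrite subr0.
  apply: (root_string_weight (q := 0) (p := 1) std t3).
  - by rewrite mulr0n addr0; apply: mem_root_pair; rewrite eq_sym.
  - rewrite mulr1n opprD addrACA subrr add0r -scaleNr -signrN.
    exact: mem_root_pair.
  - rewrite mulr1n; apply: (notin_roots std (p := p1) (q := c)); first by rewrite eq_sym.
      rewrite !linearD !linearZ /= !cE eqxx (negPf cp) [q1 == _]eq_sym (negPf pq).
      rewrite !mulr0 !addr0 mulr1 -mulr2n exprMn_n sqrr_sign.
      by rewrite lexx.
    rewrite !linearD !linearZ /= !cE eqxx ![_ == c]eq_sym (negPf cp) (negPf cq).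
    by rewrite !mulr0 !addr0 add0r mulr1 signr_eq0.
  - rewrite mulr2n; apply: (notin_roots std (p := q1) (q := p1)); first by rewrite eq_sym.
      rewrite linearB !linearD !linearZ /= !cE eqxx (negPf cq) (negPf pq).
      rewrite !mulr0 !add0r mulr1 sqrrN -mulr2n exprMn_n sqrr_sign.
      by rewrite lexx.
    rewrite linearB !linearD !linearZ /= !cE eqxx (negPf cp) [q1 == _]eq_sym (negPf pq).
    by rewrite !mulr0 !addr0 mulr1 opprD addrA subrr add0r oppr_eq0 signr_eq0.
move=> pq t3.
have t3' : sl2_triple br ((-1) ^+ s' *: e q + (-1) ^+ s *: e p) x y.
  by rewrite addrC.
have qp : q != p by rewrite eq_sym.
have sqr (s0 : bool) (z w : F) : (-1) ^+ s0 * z + w = 1 -> (-1) ^+ s0 * z - w = 1 ->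
    z = (-1) ^+ s0 /\ w = 0.
  move=> E1 E2; have w0 : w = 0.
    have : w *+ 2 = ((-1) ^+ s0 * z + w) - ((-1) ^+ s0 * z - w) by ring.
    by rewrite E1 E2 subrr => /eqP; rewrite mulrn_eq0 => /eqP.
  split=> //; apply: (inv_inj (signrMK s0)).
  by move: E1; rewrite w0 addr0 -expr2 sqrr_sign.
have E0 k : k != p -> k != q -> weight_at (e k) (br x y) = 0.
  move=> kp kq; have := string _ _ _ _ _ _ k false pq kp kq t3.
  have := string _ _ _ _ _ _ k true pq kp kq t3.
  rewrite expr0 expr1 mul1r mulN1r => E1 E2.
  by have [] := sqr _ _ _ E2 E1.
have [c cp cq] : exists2 c : 'I_n, c != p & c != q.
  case: (pickP [pred c | (c != p) && (c != q)]) => [c /andP[]|none]; first by exists c.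
  have : (#|'I_n| <= #|[set p; q]|)%N.
    apply/subset_leq_card/subsetP => c _; have := none c; rewrite !inE /=.
    by case: eqP => //= _; case: eqP.
  by rewrite card_ord cards2 pq leqNgt n_ge3.
have Ep : weight_at (e p) (br x y) = (-1) ^+ s.
  have := string _ _ _ _ _ _ c false pq cp cq t3.
  have := string _ _ _ _ _ _ c true pq cp cq t3.
  rewrite expr0 expr1 mul1r mulN1r => E1 E2.
  by have [] := sqr _ _ _ E2 E1.
have Eq : weight_at (e q) (br x y) = (-1) ^+ s'.
  have := string _ _ _ _ _ _ c false qp cq cp t3'.
  have := string _ _ _ _ _ _ c true qp cq cp t3'.
  rewrite expr0 expr1 mul1r mulN1r => E1 E2.
  by have [] := sqr _ _ _ E2 E1.
rewrite (weight_at_coord basis_eps) (bigD1 p) //= (bigD1 q) //= big1 ?addr0.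
  by rewrite Ep Eq mulrC [_ * (-1) ^+ s']mulrC.
by move=> k /andP[kp kq]; rewrite E0 ?mulr0.
Qed.

(** The coroot vanishes on [e k] for [k != c], since the string through it is the symmetric
    [e k - e c], [e k], [e k + e c]; on [e c] the value 2 is the normalization. *)
Lemma weight_at_root_short (c : 'I_n) x y nu : T = TypeB ->
  sl2_triple br (e c) x y -> weight_at nu (br x y) = coord eps c nu *+ 2.
Proof.
move=> TB t3; have cE := coord_eps basis_eps.
rewrite (weight_at_coord basis_eps) (bigD1 c) //= big1 ?addr0.
  by case: t3 => _ _ ->; rewrite mulr_natr.
move=> k kc.
suff -> : weight_at (e k) (br x y) = 0 by rewrite mulr0.
rewrite -(subrr 1); apply: (root_string_weight (q := 1) (p := 1) std t3).
- by rewrite mulr1n; have := mem_root_pair T eps false false kc; rewrite !scale1r.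
- by rewrite mulr1n; have := mem_root_pair T eps false true kc; rewrite scale1r scaleN1r.
- rewrite mulr2n; apply: (notin_roots std (p := c) (q := k)); first by rewrite eq_sym.
    rewrite !linearD /= !cE eqxx (negPf kc) add0r -natrD -natrX.
    by rewrite ler_nat.
  by rewrite !linearD /= !cE eqxx [c == k]eq_sym (negPf kc) !addr0 oner_eq0.
- rewrite mulr2n; apply: (notin_roots std (p := c) (q := k)); first by rewrite eq_sym.
    rewrite linearB !linearD /= !cE eqxx (negPf kc) add0r sqrrN -natrD -natrX.
    by rewrite ler_nat.
  by rewrite linearB !linearD /= !cE eqxx [c == k]eq_sym (negPf kc) !addr0 subr0 oner_eq0.
Qed.

(** In type C [e k] is not a root, so the string is taken through [e k - e c]: it goes up once, to
    [e k + e c], and not down, which gives -1 and hence 0 on [e k]. *)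
Lemma weight_at_root_long (c : 'I_n) x y nu : T = TypeC ->
  sl2_triple br (e c *+ 2) x y -> weight_at nu (br x y) = coord eps c nu.
Proof.
move=> TC t3; have cE := coord_eps basis_eps.
have Ec : weight_at (e c) (br x y) = 1.
  have [_ _ /eqP] := t3; rewrite -scaler_nat weight_atZ -subr_eq0.
  by rewrite -{2}[2]mulr1 -mulrBr mulf_eq0 pnatr_eq0 /= subr_eq0 => /eqP.
rewrite (weight_at_coord basis_eps) (bigD1 c) //= big1 ?addr0; first by rewrite Ec mulr1.
move=> k kc.
suff : weight_at (e k - e c) (br x y) = 0 - 1.
  by rewrite weight_atD weight_atN Ec => /addIr ->; rewrite mulr0.
apply: (root_string_weight (q := 1) (p := 0) std t3).
- rewrite mulr1n mulr2n addrA subrK.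
  by have := mem_root_pair T eps false false kc; rewrite !scale1r.
- rewrite mulr0n subr0.
  by have := mem_root_pair T eps false true kc; rewrite scale1r scaleN1r.
- apply: (notin_roots std (p := c) (q := k)); first by rewrite eq_sym.
    rewrite -mulrnA linearD linearB linearMn /= !cE eqxx (negPf kc) sub0r.
    rewrite /= (_ : (_ + _) = 3); last by rewrite mulrnA; ring.
    by rewrite -natrX ler_nat.
  rewrite -mulrnA linearD linearB linearMn /= !cE eqxx [c == k]eq_sym (negPf kc).
  by rewrite mul0rn subr0 addr0 oner_eq0.
- rewrite mulr1n; apply: (notin_roots std (p := c) (q := k)); first by rewrite eq_sym.
    rewrite !linearB linearMn /= !cE eqxx (negPf kc) sub0r.
    rewrite /= (_ : (_ - _) = - 3); last by ring.
    by rewrite sqrrN -natrX ler_nat.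
  rewrite !linearB linearMn /= !cE eqxx [c == k]eq_sym (negPf kc).
  by rewrite mul0rn !subr0 oner_eq0.
Qed.

End Coroots.

(** * The maximal parabolic subalgebra *)

Section Parabolic.
Variables (F : numFieldType) (V : vectType F) (br : lieBracket V).
Variables (h : {vspace V}) (T : classicalType) (n : nat).
Variables (eps : n.-tuple (weight h)) (i : 'I_n).
Hypothesis std : standard_realization br T eps.
Hypothesis n_ge3 : (2 < n)%N.
Hypothesis i_ltC : T = TypeC -> (i.+1 < n)%N.
Hypothesis i_ltD : T = TypeD -> (i.+2 < n)%N.
Local Notation e := (tnth eps).
Local Notation Delta := (root_system T eps).
Local Notation Pi := (simple_roots T eps).
Local Notation g_ := (@root_space _ _ br h).
Implicit Types (a b nu : weight h).

Let basis_eps : basis_of fullv eps. Proof. by case: std. Qed.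

(** This will be the alpha_q-coefficient: it is 1 on [tnth Pi i] and 0 on the other simple roots.
    The bounds on [i] in types C and D keep the last simple root supported beyond [i]. *)
Definition head_sum a : F := \sum_(k < n | (k <= i)%N) coord eps k a.

Lemma head_sumD a b : head_sum (a + b) = head_sum a + head_sum b.
Proof. by rewrite -big_split; apply: eq_bigr => k _; rewrite linearD. Qed.

Lemma head_sumZ c a : head_sum (c *: a) = c * head_sum a.
Proof. by rewrite big_distrr; apply: eq_bigr => k _; rewrite linearZ. Qed.

Lemma head_sumN a : head_sum (- a) = - head_sum a.
Proof. by rewrite -scaleN1r head_sumZ mulN1r. Qed.

Lemma head_sum_eps k : head_sum (e k) = (k <= i)%N%:R.
Proof.
rewrite /head_sum; have [ki|ki] := boolP (k <= i)%N.
  rewrite (bigD1 k) //= coord_eps // eqxx big1 ?addr0 // => l /andP[_ lk].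
  by rewrite coord_eps // eq_sym (negPf lk).
rewrite big1 // => l li; rewrite coord_eps //.
by case: eqP => // kl; rewrite kl li in ki.
Qed.

Lemma eps_nth k (kn : (k < n)%N) : eps`_k = e (Ordinal kn).
Proof. by rewrite (tnth_nth 0). Qed.

Lemma head_sum_nth k : (k < n)%N -> head_sum eps`_k = (k <= i)%N%:R.
Proof. by move=> kn; rewrite (eps_nth kn) head_sum_eps. Qed.

Lemma simple_rootE (k : 'I_n) : tnth Pi k =
  if (k.+1 < n)%N then eps`_k - eps`_k.+1
  else match T with
       | TypeB => eps`_k
       | TypeC => eps`_k *+ 2
       | TypeD => eps`_k.-1 + eps`_k
       end.
Proof. by rewrite tnth_mktuple. Qed.

Lemma head_sum_simple (k : 'I_n) : head_sum (tnth Pi k) = (k == i)%:R.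
Proof.
have kn := ltn_ord k; have iN := ltn_ord i; rewrite simple_rootE -val_eqE /=.
case: ltnP => [k1|k1].
  rewrite head_sumD head_sumN !head_sum_nth //.
  case: (ltngtP k i) => [ki|ki|ki] /=; rewrite ?subrr ?subr0 //.
have E := i_ltC; have E' := i_ltD; case: T E E' => [_ _|/(_ erefl) Hi _|_ /(_ erefl) Hi].
- by rewrite head_sum_nth //; congr (nat_of_bool _)%:R; lia.
- rewrite mulr2n head_sumD head_sum_nth //.
  have -> : (k <= i)%N = false by lia.
  have -> : ((k : nat) == i) = false by lia.
  by rewrite addr0.
- rewrite head_sumD !head_sum_nth //; last by lia.
  have -> : (k <= i)%N = false by lia.
  have -> : (k.-1 <= i)%N = false by lia.
  have -> : ((k : nat) == i) = false by lia.
  by rewrite addr0.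
Qed.

(** Descending induction on the index through [eps_k = alpha_k + eps_(k+1)]. Only the last vector
    depends on the type; in types C and D it is obtained by halving. *)
Lemma basis_simple_roots : basis_of fullv Pi.
Proof.
rewrite basisEdim size_tuple (size_basis basis_eps) leqnn andbT.
rewrite -(span_basis basis_eps); apply/span_subvP => _ /tnthP[k ->].
have PiS j : tnth Pi j \in <<Pi>>%VS by apply: memv_span; apply: mem_tnth.
rewrite (tnth_nth 0); have kn := ltn_ord k.
have [m] := ubnP (n - k)%N; elim: m {k} (k : nat) kn => // m IH k kn km.
have := PiS (Ordinal kn); rewrite simple_rootE /=.
case: ltnP => [k1|k1 kP].
  move=> kP; have := IH _ k1; rewrite -[eps`_k](subrK eps`_k.+1) => k1P.
  by apply: memvD => //; apply: k1P; lia.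
have half v : v *+ 2 \in <<Pi>>%VS -> v \in <<Pi>>%VS.
  by move=> vP; rewrite -[v]scale1r -(mulVf (_ : 2 != 0)) ?pnatr_eq0 // -scalerA scaler_nat memvZ.
have n1 : (k.-1 < n)%N by lia.
have := PiS (Ordinal n1); rewrite simple_rootE /=.
have -> : (k.-1.+1 < n)%N by lia.
have -> : k.-1.+1 = k by lia.
move: half kP; case: T => [_|half|half kP k1P] //; first by move=> /half.
apply: half; rewrite (_ : eps`_k *+ 2 = (eps`_k.-1 + eps`_k) - (eps`_k.-1 - eps`_k)).
  exact: memvB.
by rewrite opprB [RHS]addrC addrA subrK.
Qed.

(** Both sides are linear and agree on the simple roots. The gradation thereby becomes an explicit
    condition on coordinates. *)
Lemma root_coef_head_sum a : root_coef T eps i a = head_sum a.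
Proof.
rewrite {2}(coord_basis basis_simple_roots (memvf a)).
rewrite (big_morph head_sum head_sumD (_ : head_sum 0 = 0)); last first.
  by rewrite -(scale0r 0) head_sumZ mul0r.
rewrite (bigD1 i) //= big1 => [|k ki]; rewrite head_sumZ -(tnth_nth 0 Pi) head_sum_simple.
  by rewrite eqxx mulr1 addr0.
by rewrite (negPf ki) mulr0.
Qed.

Lemma levi_root_head_sum a : levi_root T eps i a -> head_sum a = 0.
Proof.
move: a; apply: span_ind => [|u v|c u].
- by rewrite -(scale0r 0) head_sumZ mul0r.
- by rewrite head_sumD => -> ->; rewrite addr0.
rewrite mem_filter head_sumZ => /andP[ui /tnthP[k uk]].
rewrite uk head_sum_simple; case: eqP => [ki|]; last by rewrite mulr0.
by rewrite uk ki eqxx in ui.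
Qed.

Lemma root_gl (p q : 'I_n) : p != q -> e p - e q \in Delta.
Proof.
by move=> pq; have := mem_root_pair T eps false true pq; rewrite scale1r scaleN1r.
Qed.

(** The difference telescopes into the simple roots with indices from [p] to [q - 1], none of which
    is [i]. *)
Lemma gl_positive_levi (p q : 'I_n) : (p < q)%N -> (q <= i)%N ->
  positive_root T eps (e p - e q) /\ levi_root T eps i (e p - e q).
Proof.
move=> pq qi.
suff [pos lev] : (forall k, 0 <= root_coef T eps k (e p - e q)) /\
    levi_root T eps i (e p - e q).
  split=> //; apply/andP; split; last by apply/forallP.
  by apply: root_gl; rewrite -val_eqE neq_ltn pq.
have freePi := basis_free basis_simple_roots.
rewrite !(tnth_nth 0); move: (q : nat) qi (ltnW pq) => {pq} {}q qi.
elim: q qi => [|q IH] qi pq'.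
  rewrite (_ : nat_of_ord p = 0%N) ?subrr; last by lia.
  by split=> [k|]; [rewrite /root_coef linear0 | apply: mem0v].
move: pq'; rewrite leq_eqVlt => /orP[/eqP->|pq'].
  by rewrite subrr; split=> [k|]; [rewrite /root_coef linear0 | apply: mem0v].
have [||pos lev] := IH; [lia|lia|].
have qn : (q < n)%N by have := ltn_ord i; lia.
have <- : eps`_p - eps`_q + tnth Pi (Ordinal qn) = eps`_p - eps`_q.+1.
  rewrite simple_rootE /= (_ : (q.+1 < n)%N); last by have := ltn_ord i; lia.
  by rewrite addrA subrK.
split=> [k|].
  rewrite /root_coef linearD addr_ge0 //; first exact: pos.
  by rewrite /= coord_tnth_free // ler0n.
apply: memvD => //; apply: memv_span; rewrite mem_filter mem_tnth andbT.
(* The simple root of index [q < i] is not the removed one, because [head_sum] takes the values 0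
   and 1 on them. *)
apply: contraTneq (oner_neq0 F) => E.
have := head_sum_simple (Ordinal qn); rewrite E head_sum_simple eqxx.
rewrite -val_eqE /= (_ : (q == i) = false) ?oner_eq0 => [/eqP|]; last by lia.
by rewrite oner_eq0.
Qed.

(** Over the integers the case analysis on signs is decided by computation. *)
Lemma sign_sum_eq (s s' b b' : bool) (d : nat) :
  ((-1) ^+ s * b%:R + (-1) ^+ s' * b'%:R == d%:R :> F) =
  ((-1) ^+ s * b%:Z + (-1) ^+ s' * b'%:Z == d%:Z :> int).
Proof.
rewrite -(eqr_int F) rmorphD !rmorphM /= !rmorph_sign.
by rewrite -!pmulrn.
Qed.

Lemma g1_rootP a : a \in Delta -> head_sum a = 1 ->
  exists2 j : 'I_n, (j <= i)%N & T = TypeB /\ a = e j \/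
    exists (k : 'I_n) (s : bool), (i < k)%N /\ a = e j + (-1) ^+ s *: e k.
Proof.
move/root_systemP; case=> [p q s s' pq|p s TB|p s TC] ->;
  rewrite ?head_sumD !head_sumZ ?head_sum_eps => /eqP.
- rewrite (sign_sum_eq _ _ _ _ 1); have [pi|pi] := leqP p i; have [qi|qi] := leqP q i.
  + by case: s; case: s'.
  + case: s => [|_]; first by case: s'.
    by exists p => //; right; exists q, s'; rewrite scale1r.
  + case: s' => [|_]; first by case: s.
    by exists q => //; right; exists p, s; rewrite scale1r addrC.
  + by case: s; case: s'.
- have := sign_sum_eq s false (p <= i)%N false 1; rewrite !mulr0 !addr0 => ->.
  have [pi|pi] := leqP p i; case: s => // _; exists p => //.
  by left; rewrite scale1r.
- rewrite mulr2n head_sumD head_sum_eps mulrDr (sign_sum_eq _ _ _ _ 1).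
  by case: s; case: (p <= i)%N.
Qed.

Lemma zn_rootP a : a \in Delta -> head_sum a = 2 ->
  exists p q : 'I_n, [/\ (p <= i)%N, (q <= i)%N, T <> TypeC -> p != q & a = e p + e q].
Proof.
move/root_systemP; case=> [p q s s' pq|p s TB|p s TC] ->;
  rewrite ?head_sumD !head_sumZ ?head_sum_eps => /eqP.
- rewrite (sign_sum_eq _ _ _ _ 2); have [pi|pi] := leqP p i; have [qi|qi] := leqP q i;
  case: s; case: s' => // _; exists p, q; split=> //; by rewrite !scale1r.
- have := sign_sum_eq s false (p <= i)%N false 2; rewrite !mulr0 !addr0 => ->.
  by case: s; case: (p <= i)%N.
- rewrite mulr2n head_sumD head_sum_eps mulrDr (sign_sum_eq _ _ _ _ 2).
  have [pi|pi] := leqP p i; case: s => // _; exists p, p; split=> //; by rewrite scale1r.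
Qed.

(** Among the Levi roots these form the classical system on the indices beyond [i]; the other Levi
    roots are the [e p - e q] with [p, q <= i]. *)
Definition tail_root a := [forall k : 'I_n, (k <= i)%N ==> (coord eps k a == 0)].

Lemma tail_rootP a :
  reflect (forall k : 'I_n, (k <= i)%N -> coord eps k a = 0) (tail_root a).
Proof.
apply: (iffP forallP) => [H k ki|H k]; last by apply/implyP => /H ->.
by have /implyP/(_ ki)/eqP := H k.
Qed.

Lemma levi_rootP a : a \in Delta -> head_sum a = 0 -> tail_root a \/
  exists p q : 'I_n, [/\ (p <= i)%N, (q <= i)%N, p != q & a = e p - e q].
Proof.
have ke (k l : 'I_n) : (k <= i)%N -> (i < l)%N -> coord eps k (e l) = 0.
  by move=> ki li; rewrite coord_eps //; case: eqP => // lk; move: li; rewrite lk ltnNge ki.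
move/root_systemP; case=> [p q s s' pq|p s TB|p s TC] ->;
  rewrite ?head_sumD !head_sumZ ?head_sum_eps => /eqP.
- rewrite (sign_sum_eq _ _ _ _ 0); have [pi|pi] := leqP p i; have [qi|qi] := leqP q i.
  + case: s; case: s' => // _; right; [exists q, p|exists p, q];
      rewrite scale1r scaleN1r; split=> //; by rewrite 1?eq_sym // addrC.
  + by case: s; case: s'.
  + by case: s; case: s'.
  + move=> _; left; apply/tail_rootP => k ki.
    by rewrite linearD !linearZ /= !ke // !mulr0 addr0.
- have := sign_sum_eq s false (p <= i)%N false 0; rewrite !mulr0 !addr0 => ->.
  have [pi|pi] := leqP p i; first by case: s.
  by move=> _; left; apply/tail_rootP => k ki; rewrite linearZ /= ke ?mulr0.
- rewrite mulr2n head_sumD head_sum_eps mulrDr (sign_sum_eq _ _ _ _ 0).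
  have [pi|pi] := leqP p i; first by case: s.
  by move=> _; left; apply/tail_rootP => k ki; rewrite linearZ linearD /= ke // addr0 mulr0.
Qed.

End Parabolic.

(** * The tensor square as a Lie module *)

Section Tensors.
Variables (F : numFieldType) (V : vectType F) (br : lieBracket V).

Lemma tens_linl (v : V) : linear (fun u : V => tens u v).
Proof. by move=> c x y; apply/matrixP => j k; rewrite !mxE linearP mulrDl mulrA. Qed.

Lemma tens_linr (u : V) : linear (tens u).
Proof.
move=> c x y; apply/matrixP => j k; rewrite !mxE linearP /= mulrDr mulrCA //.
Qed.

Lemma tens0l (v : V) : tens 0 v = 0.
Proof. by apply/matrixP => j k; rewrite !mxE linear0 mul0r. Qed.

Lemma tens0r (u : V) : tens u 0 = 0.
Proof. by apply/matrixP => j k; rewrite !mxE linear0 mulr0. Qed.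

Lemma tens_space_ind (A B : {vspace V}) (Q : tensor V -> Prop) :
    Q 0 -> (forall M N, Q M -> Q N -> Q (M + N)) ->
    (forall c u v, u \in A -> v \in B -> Q (c *: tens u v)) ->
  forall M, M \in tens_space A B -> Q M.
Proof.
move=> Q0 QD Qt; apply: span_ind => // c _ /allpairsP[[u v] [/= uA vB ->]].
by apply: Qt; apply: vbasis_mem.
Qed.

Lemma mem_tens_space (A B : {vspace V}) u v :
  u \in A -> v \in B -> tens u v \in tens_space A B.
Proof.
move=> uA vB; rewrite (coord_vbasis uA) (coord_vbasis vB).
have suml m (c : 'I_m -> F) (x : 'I_m -> V) w :
    tens (\sum_j c j *: x j) w = \sum_j c j *: tens (x j) w.
  have [f fE] := linear_lfun (tens_linl w).
  by rewrite -fE linear_sum; apply: eq_bigr => j _; rewrite linearZ /= fE.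
have sumr m (c : 'I_m -> F) (x : 'I_m -> V) w :
    tens w (\sum_j c j *: x j) = \sum_j c j *: tens w (x j).
  have [f fE] := linear_lfun (tens_linr w).
  by rewrite -fE linear_sum; apply: eq_bigr => j _; rewrite linearZ /= fE.
rewrite suml memv_suml // => j _; rewrite memvZ // sumr memv_suml // => k _.
rewrite memvZ // memv_span //; apply/allpairsP.
by exists ((vbasis A)`_j, (vbasis B)`_k); split; rewrite // mem_nth ?size_tuple.
Qed.

Lemma tens_spaceS (A A' B : {vspace V}) :
  (A <= A')%VS -> (tens_space A B <= tens_space A' B)%VS.
Proof.
move=> AA; apply/span_subvP => _ /allpairsP[[u v] [/= uA vB ->]].
by apply: mem_tens_space; [apply: (subvP AA)|]; apply: vbasis_mem.
Qed.

Lemma tens_space_full (M : tensor V) : M \in tens_space fullv fullv.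
Proof.
rewrite (matrix_sum_delta M) memv_suml // => j _; rewrite memv_suml // => k _.
rewrite memvZ //; have freeV := basis_free (vbasisP {:V}).
have -> : delta_mx j k = tens (vbasis {:V})`_j (vbasis {:V})`_k.
  apply/matrixP => p q; rewrite !mxE !coord_free // -natrM mulnb.
  by rewrite eq_sym [k == q]eq_sym.
by apply: mem_tens_space; apply: memvf.
Qed.

Lemma tens_map_linear (f g : 'End(V)) : linear (tens_map f g).
Proof.
move=> c M N; rewrite /tens_map scaler_sumr -big_split; apply: eq_bigr => j _.
rewrite scaler_sumr -big_split; apply: eq_bigr => k _.
by rewrite !mxE scalerDl scalerA.
Qed.

Lemma tens_ad_linear x : linear (tens_ad br x).
Proof.
move=> c M N; rewrite /tens_ad !tens_map_linear.
by rewrite scalerDr addrACA.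
Qed.

Lemma tens_ad_tens x u v :
  tens_ad br x (tens u v) = tens (br x u) v + tens u (br x v).
Proof. by rewrite /tens_ad !tens_mapE !adE !id_lfunE. Qed.

Lemma tens_ad_module : lie_module br (tens_ad br).
Proof.
have adL := tens_ad_linear; have adT := tens_ad_tens.
(* From here on only linearity in the tensor and the Leibniz rule on pure tensors are kept. *)
move: (tens_ad br) adL adT => act adL adT.
have ad0 x : act x 0 = 0.
  by have := adL x (-1) 0 0; rewrite scaler0 addr0 scaleN1r addNr.
have adD x M N : act x (M + N) = act x M + act x N.
  by have := adL x 1 M N; rewrite !scale1r.
have adZ x c M : act x (c *: M) = c *: act x M.
  by have := adL x c M 0; rewrite !addr0 ad0 addr0.
have tDl (x y v : V) : tens (x + y) v = tens x v + tens y v.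
  by have := tens_linl v 1 x y; rewrite !scale1r.
have tDr (x y v : V) : tens v (x + y) = tens v x + tens v y.
  by have := tens_linr v 1 x y; rewrite !scale1r.
have tZl c (x v : V) : tens (c *: x) v = c *: tens x v.
  by have := tens_linl v c x 0; rewrite !addr0 tens0l addr0.
have tZr c (x v : V) : tens v (c *: x) = c *: tens v x.
  by have := tens_linr v c x 0; rewrite !addr0 tens0r addr0.
split=> [//|x y M|a x M]; move: (tens_space_full M); move: M.
- apply: tens_space_ind => [|M N E E'|c u v _ _]; first by rewrite !ad0 subrr.
    by rewrite !adD E E' opprD addrACA.
  rewrite !adZ -scalerBr; congr (_ *: _); rewrite !adT !adD !adT.
  rewrite (lie_leibniz br x y u) (lie_leibniz br x y v) tDl tDr.
  set A := tens (br (br x y) u) v; set B := tens u (br (br x y) v).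
  set C := tens (br y (br x u)) v; set D := tens u (br y (br x v)).
  set P := tens (br y u) (br x v); set Q := tens (br x u) (br y v).
  apply/matrixP => j k; rewrite !mxE; ring.
- apply: tens_space_ind => [|M N E E'|c u v _ _]; first by rewrite !ad0 scaler0.
    by rewrite !adD E E' scalerDr.
  rewrite !adZ !adT !lie_brZl tZl tZr -scalerDr !scalerA mulrC //.
Qed.

End Tensors.

(** * Dominance, and the roots beyond the index [i] *)

Section ParabolicWeights.
Variables (F : numFieldType) (V : vectType F) (br : lieBracket V).
Variables (h : {vspace V}) (T : classicalType) (n : nat).
Variables (eps : n.-tuple (weight h)) (i : 'I_n).
Hypothesis std : standard_realization br T eps.
Hypothesis n_ge3 : (2 < n)%N.
Hypothesis i_ltC : T = TypeC -> (i.+1 < n)%N.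
Hypothesis i_ltD : T = TypeD -> (i.+2 < n)%N.
Local Notation e := (tnth eps).
Local Notation Delta := (root_system T eps).
Local Notation Pi := (simple_roots T eps).
Local Notation g_ := (@root_space _ _ br h).
Local Notation tail_root := (tail_root eps i).
Local Notation head_sum := (head_sum eps i).
Implicit Types (a b nu : weight h).

Let basis_eps : basis_of fullv eps. Proof. by case: std. Qed.
Let cartan_h : cartan_subalgebra br h. Proof. by case: std. Qed.

Lemma separating_vector a b :
  a != b -> exists2 x, x \in h & weight_at a x != weight_at b x.
Proof.
move=> ab; case: (boolP [exists k, coord eps k a != coord eps k b]) => [/existsP[k]|].
  have [x xh xE] := dual_eps basis_eps k; exists x => //.
  have cE c : weight_at c x = coord eps k c.
    rewrite (weight_at_coord basis_eps) (bigD1 k) //= xE eqxx mulr1 big1 ?addr0 //.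
    by move=> l lk; rewrite xE (negPf lk) mulr0.
  by rewrite !cE.
rewrite negb_exists => /forallP E; case/eqP: ab; apply: (coord_inj basis_eps) => k.
by have := E k; rewrite negbK => /eqP.
Qed.

(** If [nu] were not among the summed roots, each of them would differ from [nu] at some element of
    [h], and the weight vector would be separated from all summands. *)
Lemma weight_of_sum (P : pred (weight h)) w nu :
    w \in (\sum_(a <- Delta | P a) g_ a)%VS -> w != 0 -> w \in g_ nu ->
  nu \in Delta /\ P nu.
Proof.
rewrite -big_filter => wS w0 wnu; set s := filter _ _ in wS.
have [|nus] := boolP (nu \in s).
  by rewrite mem_filter => /andP[].
case/eqP: w0; apply: (eigen_separated_sum (s := s) (U := g_)) wS => a aS.
have [|x xh xE] := @separating_vector nu a.
  by apply: contraNneq nus => ->.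
exists (ad br x), (weight_at nu x), (weight_at a x); split=> //.
- by rewrite adE; move/mem_root_space: wnu => ->.
- by move=> u /mem_root_space; rewrite adE; apply.
- by move=> b u _ ub; rewrite adE; move/mem_root_space: (ub) => -> //; apply: memvZ.
Qed.

Lemma graded_weight (d : nat) nu :
    highest_weight br T eps i br (graded br T eps i d) nu ->
  nu \in Delta /\ head_sum nu = d%:R.
Proof.
move=> [w [wW w0 wnu _]].
have wg : w \in g_ nu by apply/root_spaceP.
have [nuD /eqP] := weight_of_sum wW w0 wg.
by rewrite (root_coef_head_sum std n_ge3).
Qed.

(** The module is arbitrary so that the lemma serves g(1) and z(n) as well as the tensor product. *)
Lemma dominant_weight (M : vectType F) (act : V -> M -> M) W nu (p q : 'I_n) :
    lie_module br act -> highest_weight br T eps i act W nu ->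
    (p < q)%N -> (q <= i)%N ->
  exists m : nat, coord eps p nu - coord eps q nu = m%:R.
Proof.
move=> actM [w [_ w0 wnu wpos]] pq qi.
have pq' : p != q by rewrite -val_eqE neq_ltn pq.
have [pos lev] := gl_positive_levi std n_ge3 i_ltC i_ltD pq qi.
have [x [y [t3 _]]] := exists_sl2_triple std n_ge3 (root_gl T eps pq').
have [xb yb _] := t3.
have th := sl2_triple_cartan cartan_h t3.
have [||m [mE _]] := sl2_module_highest_weight (c := weight_at nu (br x y))
    cartan_h actM t3 _ _ w0.
- exact: (wpos _ _ pos lev xb).
- by have := wnu (vsproj h (br x y)); rewrite vsprojK.
exists m; rewrite -mE.
have := @weight_at_root_pair _ _ _ _ _ _ _ std n_ge3 p q false true x y nu pq'.
rewrite scale1r scaleN1r mul1r mulN1r => -> //.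
Qed.

(** Root spaces alone suffice: by Jacobi, what commutes with them commutes with the subalgebra they
    generate. *)
Definition tail_space : {vspace V} := (\sum_(a <- Delta | tail_root a) g_ a)%VS.

Lemma mem_tail_space a x :
  a \in Delta -> tail_root a -> x \in g_ a -> x \in tail_space.
Proof. by move=> aD aT; apply/subvP; apply: (subv_big_seq g_). Qed.

Lemma tail_root_coord b : b \in Delta -> tail_root b ->
  exists2 c : 'I_n, (i < c)%N & coord eps c b != 0.
Proof.
move=> bD /tail_rootP bT.
case: (boolP [exists c, coord eps c b != 0]) => [/existsP[c cb]|].
  by exists c => //; rewrite ltnNge; apply: contraNN cb => /bT ->.
rewrite negb_exists => /forallP b0; case/eqP: (root_neq0 std bD).
apply: (coord_inj basis_eps) => k; have := b0 k; rewrite negbK => /eqP ->.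
by rewrite linear0.
Qed.

(** The supports of [a] and [b] are disjoint, so [a + b] has either three nonzero coordinates or one
    of modulus at least 2 beside another nonzero one, and no root has either. This covers
    [e p - e q], [e p + e q] and [2 e p] together. *)
Lemma lie_tail_eq0 a b x y :
    (forall c : 'I_n, (i < c)%N -> coord eps c a = 0) ->
    (exists p q : 'I_n, [/\ (p <= i)%N, (q <= i)%N, p != q,
       coord eps p a != 0 & coord eps q a != 0]) \/
    (exists2 p : 'I_n, (p <= i)%N & 4 <= coord eps p a ^+ 2) ->
    b \in Delta -> tail_root b -> x \in g_ a -> y \in g_ b ->
  br x y = 0.
Proof.
move=> a0 aP bD bT xa yb; have [c ci bc] := tail_root_coord bD bT.
suff ab : a + b \notin 0 :: Delta.
  apply/eqP; rewrite -memv0; move: ab; rewrite inE negb_or => /andP[ab0 abD].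
  by rewrite -(root_space_eq0 std ab0 abD); apply: lie_root_space.
have /tail_rootP b0 := bT.
have abc : coord eps c (a + b) != 0 by rewrite linearD /= a0 // add0r.
have abp (p : 'I_n) : (p <= i)%N -> coord eps p (a + b) = coord eps p a.
  by move=> pi; rewrite linearD /= b0 // addr0.
have pc (p : 'I_n) : (p <= i)%N -> p != c.
  by move=> pi; apply: contraTneq ci => <-; rewrite -leqNgt.
case: aP => [[p [q [pi qi pq ap aq]]]|[p pi ap]]; last first.
  by apply: (notin_roots std (pc p pi)) => //; rewrite abp.
rewrite inE negb_or; apply/andP; split.
  by apply: contraNneq abc => ->; rewrite linear0.
apply/negP => abD.
have := root_three_coords basis_eps abD pq (pc p pi) (pc q qi).
by rewrite (abp p pi) (abp q qi) (negPf ap) (negPf aq) (negPf abc).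
Qed.

End ParabolicWeights.

(** * The simple ideal l_gamma and the special constituents *)

Section Constituents.
Variables (F : numFieldType) (V : vectType F) (br : lieBracket V).
Variables (h : {vspace V}) (T : classicalType) (n : nat).
Variables (eps : n.-tuple (weight h)) (i : 'I_n).
Hypothesis std : standard_realization br T eps.
Hypothesis n_ge3 : (2 < n)%N.
Hypothesis i_ltC : T = TypeC -> (i.+1 < n)%N.
Hypothesis i_ltD : T = TypeD -> (i.+2 < n)%N.
Local Notation e := (tnth eps).
Local Notation Delta := (root_system T eps).
Local Notation Pi := (simple_roots T eps).
Local Notation g_ := (@root_space _ _ br h).
Local Notation tail_root := (tail_root eps i).
Local Notation head_sum := (head_sum eps i).
Local Notation tail_space := (tail_space br T eps i).
Local Notation levi := (levi br T eps i).
Implicit Types (a b nu : weight h).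

Let basis_eps : basis_of fullv eps. Proof. by case: std. Qed.
Let cartan_h : cartan_subalgebra br h. Proof. by case: std. Qed.
Let coordE := coord_eps basis_eps.

Lemma mem_levi a x : levi_root T eps i a -> x \in g_ a -> x \in levi.
Proof.
move=> aL xa; have [a0|a0] := eqVneq a 0.
  by apply: (subvP (addvSl _ _)); rewrite -(root_space0 cartan_h) -a0.
have [aD|aD] := boolP (a \in Delta).
  by apply: (subvP (addvSr _ _)); apply: (subvP (subv_big_seq g_ aD aL)).
by move: xa; rewrite (root_space_eq0 std a0 aD) memv0 => /eqP->; apply: mem0v.
Qed.

Lemma levi_ind (Q : V -> Prop) :
    (forall x y, Q x -> Q y -> Q (x + y)) ->
    (forall a x, a \in 0 :: Delta -> levi_root T eps i a -> x \in g_ a -> Q x) ->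
  forall x, x \in levi -> Q x.
Proof.
move=> QD Qa x /memv_addP[u uh [v vS ->]]; apply: (QD).
  by apply: (Qa 0); rewrite ?mem_head ?(root_space0 cartan_h) //; apply: mem0v.
move: vS; rewrite big_seq_cond; move: v; apply: memv_sum_ind.
- by apply: (Qa 0); rewrite ?mem_head ?mem0v //; apply: mem0v.
- exact: QD.
- by move=> a v /andP[aD aL] va; apply: (Qa a); rewrite // inE aD orbT.
Qed.

Lemma lie_levi x y : x \in levi -> y \in levi -> br x y \in levi.
Proof.
move=> xL; move: y; apply: levi_ind => [u v|b y _ bL yb].
  by rewrite linearD; apply: memvD.
move: x xL; apply: levi_ind => [u v|a x _ aL xa].
  by rewrite lie_brDl; apply: memvD.
by apply: (mem_levi (a := a + b)); [apply: memvD | apply: lie_root_space].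
Qed.

Lemma tail_space_ind (Q : V -> Prop) :
    Q 0 -> (forall x y, Q x -> Q y -> Q (x + y)) ->
    (forall a x, a \in Delta -> tail_root a -> x \in g_ a -> Q x) ->
  forall x, x \in tail_space -> Q x.
Proof.
move=> Q0 QD Qa x; rewrite /tail_space big_seq_cond; move: x.
by apply: memv_sum_ind => // a x /andP[]; apply: Qa.
Qed.

Lemma eps_head_coord (p c : 'I_n) : (p <= i)%N -> (i < c)%N -> (p == c) = false.
Proof. by move=> pi ci; apply: contraTF ci => /eqP <-; rewrite -leqNgt. Qed.

Lemma lie_gl_tail (p q : 'I_n) b x y :
    (p <= i)%N -> (q <= i)%N -> p != q -> b \in Delta -> tail_root b ->
  x \in g_ (e p - e q) -> y \in g_ b -> br x y = 0.
Proof.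
move=> pi qi pq; apply: (lie_tail_eq0 std (i := i)) => [c ci|].
  by rewrite linearB /= !coordE !eps_head_coord // subrr.
left; exists p, q; split=> //; rewrite linearB /= !coordE eqxx.
  by rewrite [q == p]eq_sym (negPf pq) subr0 oner_eq0.
by rewrite (negPf pq) sub0r oppr_eq0 oner_eq0.
Qed.

Lemma lie_zn_tail a b x y :
    a \in Delta -> head_sum a = 2 -> b \in Delta -> tail_root b ->
  x \in g_ a -> y \in g_ b -> br x y = 0.
Proof.
move=> aD a2; have [p [q [pi qi _ ->]]] := zn_rootP std aD a2.
apply: (lie_tail_eq0 std (i := i)) => [c ci|].
  by rewrite linearD /= !coordE !eps_head_coord // addr0.
have [<-|pq] := eqVneq p q.
  right; exists p => //; rewrite linearD /= !coordE eqxx -natrD -natrX.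
  by rewrite ler_nat.
left; exists p, q; split=> //; rewrite linearD /= !coordE eqxx.
  by rewrite [q == p]eq_sym (negPf pq) addr0 oner_eq0.
by rewrite (negPf pq) add0r oner_eq0.
Qed.

(** For [y] in a tail root space, [[y, [z, x]] = [[y, z], x]]. If [z] is in [h], [[y, z]] is a
    multiple of [y]; if [z] is a tail root vector it commutes with [x] too; if its root is
    [e p - e q], then [[y, z] = 0]. *)
Lemma centralizer_tail_levi z x : z \in levi ->
  x \in centralizer br tail_space -> br z x \in centralizer br tail_space.
Proof.
move=> zL /centralizerP xC; move: z zL; apply: levi_ind => [u v|a z aD aL za].
  by rewrite lie_brDl; apply: memvD.
apply/centralizerP; apply: tail_space_ind => [|u v|b y bD bT yb].
- exact: lie_br0l.
- by rewrite lie_brDl => -> ->; rewrite addr0.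
have yx : br y x = 0 by apply: xC; apply: mem_tail_space yb.
rewrite lie_leibniz yx linear0 addr0 (lie_brC br y z) lie_brNl.
move: aD; rewrite inE => /orP[/eqP a0|aD].
  move: za; rewrite a0 (root_space0 cartan_h) => zh.
  by move/mem_root_space: yb => -> //; rewrite lie_brZl yx scaler0 oppr0.
have [aT|[p [q [pi qi pq aE]]]] := levi_rootP std aD
    (levi_root_head_sum std n_ge3 i_ltC i_ltD aL).
  have zx : br z x = 0 by apply: xC; apply: mem_tail_space za.
  have := lie_leibniz br z y x; rewrite yx zx !linear0 addr0 => <-.
  by rewrite oppr0.
by rewrite aE in za; rewrite (lie_gl_tail pi qi pq bD bT za yb) lie_br0l oppr0.
Qed.

Lemma simple_root_head_coord (k l : 'I_n) :
  (i <= k)%N -> (l < i)%N -> coord eps l (tnth Pi k) = 0.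
Proof.
move=> ik li; rewrite simple_rootE; have kn := ltn_ord k.
have c0 m (mn : (m < n)%N) : (l < m)%N -> coord eps l eps`_m = 0.
  move=> lm; rewrite (eps_nth _ mn) coordE; case: eqP => // E.
  by move: lm; rewrite -E /= ltnn.
case: ltnP => [k1|k1].
  by rewrite linearB /= !c0 ?subrr //; lia.
have E := i_ltD; case: T E => [_|_|/(_ erefl) Hi].
- by rewrite c0 //; lia.
- by rewrite linearMn /= c0 ?mul0rn //; lia.
- by rewrite linearD /= !c0 ?addr0 //; lia.
Qed.

Lemma l_gamma_subv_levi gamma lg :
  is_l_gamma br T eps i gamma lg -> (lg <= levi)%VS.
Proof.
move=> [[lgd _] _ _]; apply: (subv_trans lgd).
by apply: mem_derived => x y; apply: lie_levi.
Qed.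

Lemma l_gamma_centralizes_tail gamma lg :
    is_l_gamma br T eps i gamma lg ->
    (forall k : 'I_n, (i <= k)%N -> coord eps k gamma = 0) ->
  (lg <= centralizer br tail_space)%VS.
Proof.
move=> lgP gam0; have lgL := l_gamma_subv_levi lgP.
have [[lgd lgI] [_ lgS] [a [/tnthP[k ak] dot] alg]] := lgP.
(* Simple roots of index at least [i] have no coordinate below [i], where all of gamma lies, so they
   are orthogonal to it. *)
have ki : (k < i)%N.
  rewrite ltnNge; apply: contraNN dot => ik; rewrite /weight_dot big1 // => l _.
  have [il|li] := leqP i l; first by rewrite gam0 ?mulr0.
  by rewrite ak simple_root_head_coord ?mul0r.
have k1 : (k.+1 < n)%N by have := ltn_ord i; lia.
have aE : a = e k - e (Ordinal k1).
  by rewrite ak simple_rootE k1 !(tnth_nth 0).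
have kq : k != Ordinal k1 by rewrite -val_eqE /= neq_ltn leqnn.
have [x xa x0] := root_vector std (root_gl T eps kq).
set C := centralizer br tail_space.
(* The intersection is nonzero because it contains the root vector [x] of alpha_gamma. *)
have [||E] := lgS (lg :&: C)%VS.
- split; first exact: capvSl.
  move=> u v ulg; rewrite !memv_cap => /andP[vlg vC]; apply/andP; split.
    by apply: lgI => //; apply: (subvP lgd).
  by apply: centralizer_tail_levi => //; apply: (subvP lgL).
- move=> E; case/eqP: x0; apply/eqP; rewrite -memv0 -E memv_cap.
  rewrite (subvP alg) ?aE //=; apply/centralizerP.
  apply: tail_space_ind => [|u v|b y bD bT yb]; first exact: lie_br0l.
    by rewrite lie_brDl => -> ->; rewrite addr0.
  by rewrite lie_brC (lie_gl_tail (ltnW ki) _ kq bD bT xa yb) ?oppr0.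
- by rewrite -E; apply: capvSr.
Qed.

Section TailWeight.
Variables (lg : {vspace V}) (W : {vspace tensor V}) (nu : weight h).
Hypothesis lgC : (lg <= centralizer br tail_space)%VS.
Hypothesis Wlg : (W <= tens_space lg (zn br T eps i))%VS.
Hypothesis Wnu : highest_weight br T eps i (tens_ad br) W nu.

(** Both [x] and [y] kill the highest weight vector, since tail root vectors commute with [lg] and
    with z(n); hence so does their bracket. *)
Lemma tail_coroot_weight b x y :
    b \in Delta -> tail_root b -> sl2_triple br b x y ->
  weight_at nu (br x y) = 0.
Proof.
move=> bD bT t3; have th := sl2_triple_cartan cartan_h t3; have [xb yb b2] := t3.
have [w [wW w0 wnu _]] := Wnu; have [_ adB _] := tens_ad_module br.
have kill c z : c \in Delta -> tail_root c -> z \in g_ c -> tens_ad br z w = 0.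
  move=> cD cT zc; move: (subvP Wlg _ wW); move: (w).
  have adL := tens_ad_linear br z.
  have [f fE] := linear_lfun adL.
  apply: tens_space_ind => [|M N|d u v ulg vzn].
  - by rewrite -fE linear0.
  - by rewrite -!fE linearD /= => -> ->; rewrite addr0.
  rewrite -fE linearZ /= fE tens_ad_tens.
  have /centralizerP -> := subvP lgC _ ulg; last exact: mem_tail_space zc.
  suff -> : br z v = 0 by rewrite tens0l tens0r addr0 scaler0.
  move: vzn; rewrite /zn /graded big_seq_cond; move: v.
  apply: memv_sum_ind => [|v1 v2|a v /andP[aD]]; first exact: linear0.
    by rewrite linearD /= => -> ->; rewrite addr0.
  rewrite (root_coef_head_sum std n_ge3 i_ltC i_ltD) => /eqP a2 va.
  by rewrite lie_brC (lie_zn_tail aD a2 cD cT va zc) oppr0.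
have nbD : - b \in Delta.
  apply: contraT => nbD; have b0 := root_neq0 std bD.
  move: yb; rewrite (root_space_eq0 std _ nbD) ?oppr_eq0 // memv0 => /eqP y0.
  by move: b2; rewrite y0 linear0 /weight_at !linear0 => /esym/eqP; rewrite pnatr_eq0.
have nbT : tail_root (- b).
  by apply/tail_rootP => k ki; rewrite linearN /= (tail_rootP _ _ _ bT) ?oppr0.
have := adB x y w; rewrite (kill _ _ bD bT xb) (kill _ _ nbD nbT yb).
have := tens_ad_linear br x (-1) 0 0; rewrite scaler0 addr0 scaleN1r addNr => ->.
have := tens_ad_linear br y (-1) 0 0; rewrite scaler0 addr0 scaleN1r addNr => ->.
have := wnu (vsproj h (br x y)); rewrite vsprojK // => ->; rewrite subrr => /eqP.
by rewrite scaler_eq0 (negPf w0) orbF => /eqP.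
Qed.

Lemma tail_coord_eq0 (c : 'I_n) : (i < c)%N -> coord eps c nu = 0.
Proof.
move=> ci.
have tailE (k : 'I_n) (l : 'I_n) : (k <= i)%N -> (i < l)%N -> coord eps k (e l) = 0.
  by move=> ki il; rewrite coordE eq_sym eps_head_coord.
have twice (z : F) : z *+ 2 = 0 -> z = 0.
  by move/eqP; rewrite mulrn_eq0 => /eqP.
case E : T.
- have bD : e c \in Delta by have := mem_root_short eps c false E; rewrite scale1r.
  have [x [y [t3 _]]] := exists_sl2_triple std n_ge3 bD.
  apply: twice; rewrite -(weight_at_root_short std nu E t3).
  by apply: (tail_coroot_weight bD) => //; apply/tail_rootP => k ki; apply: tailE.
- have bD : e c *+ 2 \in Delta by have := mem_root_long eps c false E; rewrite scale1r.
  have [x [y [t3 _]]] := exists_sl2_triple std n_ge3 bD.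
  rewrite -(weight_at_root_long std nu E t3).
  apply: (tail_coroot_weight bD) => //; apply/tail_rootP => k ki.
  by rewrite linearMn /= tailE ?mul0rn.
(* Type D has no root on a single index, so [c] is paired with another tail index, [i + 1] or
   [i + 2], and both signs are used. *)
- have [d di dc] : exists2 d : 'I_n, (i < d)%N & c != d.
    have i2 := i_ltD E; have i1 := ltnW i2.
    have [->|cn] := eqVneq c (Ordinal i1); last by exists (Ordinal i1).
    by exists (Ordinal i2); rewrite //= -val_eqE /= neq_ltn leqnn.
  have val (s : bool) : coord eps c nu + (-1) ^+ s * coord eps d nu = 0.
    have bD := mem_root_pair T eps false s dc.
    have [x [y [t3 _]]] := exists_sl2_triple std n_ge3 bD.
    have := weight_at_root_pair std n_ge3 nu dc t3; rewrite mul1r => <-.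
    apply: (tail_coroot_weight bD) => //; apply/tail_rootP => k ki.
    by rewrite linearD !linearZ /= !tailE // !mulr0 addr0.
  apply: twice; have := val false; have := val true.
  rewrite mul1r mulN1r => E1 E2.
  by rewrite mulr2n -[X in X + _](subrK (coord eps d nu)) E1 add0r addrC.
Qed.

End TailWeight.
End Constituents.

(** * Determination of gamma and of the special weights *)

Section SpecialConstituents.
Variables (F : numFieldType) (V : vectType F) (br : lieBracket V).
Variables (h : {vspace V}) (T : classicalType) (n : nat).
Variables (eps : n.-tuple (weight h)) (i : 'I_n).
Hypothesis std : standard_realization br T eps.
Hypothesis n_ge3 : (2 < n)%N.
Hypothesis i_ltC : T = TypeC -> (i.+1 < n)%N.
Hypothesis i_ltD : T = TypeD -> (i.+2 < n)%N.
Hypothesis i_gt0 : (0 < i)%N.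
Hypothesis i_gt1 : T <> TypeC -> (1 < i)%N.
Local Notation e := (tnth eps).
Local Notation Delta := (root_system T eps).
Local Notation g_ := (@root_space _ _ br h).
Local Notation head_sum := (head_sum eps i).
Implicit Types (a b nu : weight h).

Let basis_eps : basis_of fullv eps. Proof. by case: std. Qed.
Let cartan_h : cartan_subalgebra br h. Proof. by case: std. Qed.
Let coordE := coord_eps basis_eps.
Let o0 : 'I_n := Ordinal (ltnW (ltnW n_ge3)).
Let o1 : 'I_n := Ordinal (ltnW n_ge3).

Definition gl_dominant nu := forall p q : 'I_n, (p < q)%N -> (q <= i)%N ->
  exists m : nat, coord eps p nu - coord eps q nu = m%:R.

Lemma neg_nat_neq (k m : nat) : - k.+1%:R <> m%:R :> F.
Proof.
move/eqP; rewrite eq_sym -subr_eq0 opprK -natrD pnatr_eq0 addnS //.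
Qed.

(** If 0 is neither [p] nor [q], coordinate 0 is smaller than a later one; if [p = 0] and [q > 1],
    coordinate 1 is smaller than coordinate [q]. *)
Lemma gl_dominant_pair (p q : 'I_n) : (p <= i)%N -> (q <= i)%N ->
    gl_dominant (e p + e q) ->
  e p + e q = e o0 + e o0 \/ e p + e q = e o0 + e o1.
Proof.
wlog pq : p q / (p <= q)%N => [H pi qi dom|pi qi dom].
  case: (leqP p q) => [pq|/ltnW qp]; first exact: H.
  by rewrite addrC; apply: H; rewrite // addrC.
have p0 : p = o0.
  apply/eqP; apply: contraT; rewrite -val_eqE /= -lt0n => p_gt0.
  have [m] := dom o0 p p_gt0 pi; rewrite !linearD /= !coordE eqxx -!val_eqE /=.
  rewrite gtn_eqF // gtn_eqF ?(leq_trans p_gt0) // addr0 sub0r -natrD.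
  by case: (_ == _) => /neg_nat_neq.
rewrite {}p0 in pi pq dom *.
have [->|q0] := eqVneq q o0; first by left.
have [->|q1] := eqVneq q o1; first by right.
have q_gt1 : (1 < q)%N.
  by move: q0 q1; rewrite -!val_eqE /=; case: (nat_of_ord q) => [|[]].
have [m] := dom o1 q q_gt1 qi; rewrite !linearD /= !coordE eqxx (negPf q1).
rewrite eq_sym in q0; rewrite (negPf q0) -val_eqE /= !add0r.
by move/(neg_nat_neq (k := 0)).
Qed.

(** This weight is the middle of the string [2 eps_1], [eps_0 + eps_1], [2 eps_0]. Its root space is
    a line, so raising [u] once reaches a multiple of [w], and raising twice would give zero, though
    the string has three nonzero terms. *)
Lemma typeC_highest_zn W :
  T = TypeC -> ~ highest_weight br T eps i br W (e o0 + e o1).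
Proof.
move=> TC [w [_ w0 wnu wpos]].
have o01 : o0 != o1 by [].
have wg : w \in g_ (e o0 + e o1) by apply/root_spaceP.
have [pos lev] := @gl_positive_levi _ _ _ _ _ _ _ _ std n_ge3 i_ltC i_ltD o0 o1 isT i_gt0.
have bD := root_gl T eps o01.
have [x [y [t3 _]]] := exists_sl2_triple std n_ge3 bD.
have th := sl2_triple_cartan cartan_h t3.
have [xb yb _] := t3; have xw := wpos _ _ pos lev xb.
have uD : e o1 *+ 2 \in Delta by have := mem_root_long eps o1 false TC; rewrite scale1r.
have [u ug u0] := root_vector std uD.
have yu : br y u = 0.
  apply/eqP; rewrite -memv0; have := lie_root_space yb ug.
  have : - (e o0 - e o1) + e o1 *+ 2 \notin 0 :: Delta.
    rewrite opprB; apply: (notin_roots std (p := o1) (q := o0)) => //.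
      rewrite linearD linearB linearMn /= !coordE eqxx -val_eqE /= subr0.
      by rewrite -natrD -natrX ler_nat.
    rewrite linearD linearB linearMn /= !coordE eqxx -val_eqE /= mul0rn addr0 sub0r.
    by rewrite oppr_eq0 oner_eq0.
  by rewrite inE negb_or => /andP[n0 nD]; rewrite (root_space_eq0 std n0 nD).
have [|m [/eqP + mP]] := sl2_lowest_weight (c := 2) cartan_h t3 yu _ u0.
  move/mem_root_space: ug => /(_ _ th) ->; congr (_ *: _).
  have := @weight_at_root_pair _ _ _ _ _ _ _ std n_ge3 o0 o1 false true x y (e o1 *+ 2) o01.
  rewrite scale1r scaleN1r mul1r mulN1r => -> //.
  by rewrite !linearMn /= !coordE eqxx -val_eqE /= mul0rn add0r.
rewrite eqr_nat => /eqP m2; rewrite -m2 in mP.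
have gD : - (e o0 + e o1) \in Delta.
  by have := mem_root_pair T eps true true o01; rewrite !scaleN1r opprD.
(* The triple is taken for the negative root, so that [y'] spans the root space containing [w]. *)
have [x' [y' [_ line]]] := exists_sl2_triple std n_ge3 gD; rewrite opprK in line.
have xug : br x u \in g_ (e o0 + e o1).
  by have := lie_root_space xb ug; rewrite mulr2n addrA subrK.
have /vlineP[c1 wE] := subvP line _ wg; have /vlineP[c2 uE] := subvP line _ xug.
have c10 : c1 != 0 by apply: contraNneq w0 => c0; rewrite wE c0 scale0r.
have y'E : y' = c1^-1 *: w by rewrite wE scalerA mulVf ?scale1r.
have := mP 2%N isT; rewrite /= uE y'E scalerA linearZ /= xw scaler0 eqxx //.
Qed.

Variables (mu gamma : weight h) (lg : {vspace V}) (W : {vspace tensor V}).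
Variable nu : weight h.
Hypothesis hw_mu : highest_weight br T eps i br (g1 br T eps i) mu.
Hypothesis hw_gamma : highest_weight br T eps i br (zn br T eps i) gamma.
Hypothesis lgP : is_l_gamma br T eps i gamma lg.
Hypothesis WP : constituent br T eps i (tens_space lg (zn br T eps i)) W nu.

Let adjoint_dominant (U : {vspace V}) a :
  highest_weight br T eps i br U a -> gl_dominant a.
Proof.
move=> Ua p q.
exact: (dominant_weight std n_ge3 i_ltC i_ltD (adjoint_module br) Ua).
Qed.

Lemma gammaE : gamma = e o0 + e (if T is TypeC then o0 else o1).
Proof.
have [gD g2] := graded_weight std n_ge3 i_ltC i_ltD hw_gamma.
have [p [q [pi qi pq gE]]] := zn_rootP std gD g2.
have := adjoint_dominant hw_gamma; rewrite gE => /(gl_dominant_pair pi qi) [] E.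
  (* In types B and D this contradicts [p != q]; in type C it is the actual value of gamma. *)
  have pqE : p = q.
    apply/eqP; apply: contraT => npq; have /eqP := congr1 (coord eps p) E.
    rewrite !linearD /= !coordE eqxx [q == p]eq_sym (negPf npq) -!natrD eqr_nat.
    by case: (o0 == p).
  rewrite E; move: pq; rewrite pqE eqxx; case: T => // H.
    by suff: false by []; apply: H.
  by suff: false by []; apply: H.
rewrite E; case ET : T => //; exfalso.
by apply: (@typeC_highest_zn (zn br T eps i) ET); rewrite -E -gE.
Qed.

(** Dominance leaves two candidates, and the [match] selects the one different from gamma, so that
    the three types are treated at once. *)
Lemma special_constituent_iff :
  special_constituent br T eps i mu gamma W nu <->
  nu = e o0 + e (if T is TypeC then o1 else o0).
Proof.
have [irrW hw_nu] := WP; have [Wlg W0 Wst Wmin] := irrW.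
have [muD mu1] := graded_weight std n_ge3 i_ltC i_ltD hw_mu.
have [j ji muE] := g1_rootP std muD mu1.
have headE a (p : 'I_n) : (p <= i)%N -> T = TypeB /\ a = e p \/
    (exists (k : 'I_n) (s : bool), (i < k)%N /\ a = e p + (-1) ^+ s *: e k) ->
    forall k : 'I_n, (k <= i)%N -> coord eps k a = (p == k)%:R.
  move=> pi [[_ ->] k ki|[l [s [il ->]]] k ki]; first by rewrite coordE.
  by rewrite linearD linearZ /= !coordE [l == k]eq_sym (eps_head_coord ki il) mulr0 addr0.
split=> [[_ nu_gamma [a [aD ag1] nuE]]|nuE].
  have [x xa x0] := root_vector std aD.
  have [_ /eqP] := weight_of_sum std (subvP ag1 _ xa) x0 xa.
  rewrite (root_coef_head_sum std n_ge3 i_ltC i_ltD) => a1.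
  have [l li aE] := g1_rootP std aD a1.
  have tail (c : 'I_n) : (i < c)%N -> coord eps c nu = 0.
    apply: (tail_coord_eq0 std n_ge3 i_ltC i_ltD _ Wlg hw_nu).
    apply: (l_gamma_centralizes_tail std n_ge3 i_ltC i_ltD lgP) => k ik.
    (* Here the lower bounds on [i] enter: gamma is supported on index 0 in type C and on indices 0
       and 1 otherwise. *)
    rewrite gammaE linearD /= !coordE -!val_eqE /= ltn_eqF ?(leq_trans i_gt0) //.
    rewrite add0r; case E : T; rewrite ltn_eqF ?(leq_trans i_gt0) //;
      by apply: leq_trans ik; apply: i_gt1; rewrite E.
  (* The coordinates beyond [i] of the two roots of g(1) cancel because those of [nu] vanish. *)
  have {}nuE : nu = e j + e l.
    apply: (coord_inj basis_eps) => k; have [ki|ik] := leqP k i.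
      by rewrite nuE !linearD /= (headE _ _ ji muE k ki) (headE _ _ li aE k ki) !coordE.
    by rewrite tail // linearD /= !coordE (eps_head_coord ji ik) (eps_head_coord li ik) addr0.
  have dom : gl_dominant nu.
    move=> p q.
    exact: (dominant_weight std n_ge3 i_ltC i_ltD (tens_ad_module br) hw_nu).
  move: nu_gamma dom; rewrite gammaE nuE => nu_gamma /(gl_dominant_pair ji li).
  by move: nu_gamma; case: T => ? [].
have o01 : o0 != o1 by [].
split.
- split=> //; split=> //; apply: subv_trans Wlg _; apply: tens_spaceS.
  exact: l_gamma_subv_levi lgP.
- rewrite nuE gammaE => /addrI; case: T => /(congr1 (coord eps o0)) /eqP;
    by rewrite !coordE eqr_nat.
pose t := if T is TypeC then o1 else o0; rewrite -/t in nuE.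
have ti : (t <= i)%N by rewrite /t; case: T.
(* Otherwise coordinate 0 of mu is 0 while its coordinate [j] is 1, against dominance. *)
have j0 : j = o0.
  apply/eqP; apply: contraT; rewrite -val_eqE /= -lt0n => j_gt0.
  have [m] := adjoint_dominant hw_mu (p := o0) j_gt0 ji.
  rewrite !(headE _ _ ji muE) // eqxx -val_eqE /= gtn_eqF // sub0r.
  by move/(neg_nat_neq (k := 0)).
have mem_g1 a : a \in Delta -> head_sum a = 1 -> roots_in br T eps (g1 br T eps i) a.
  move=> aD a1; split=> //; apply: (subv_big_seq g_) => //.
  by rewrite (root_coef_head_sum std n_ge3 i_ltC i_ltD) a1.
rewrite {}j0 in muE; case: muE => [[TB muE]|[k [s [ik muE]]]].
  exists (e t); last by rewrite nuE muE.
  apply: mem_g1; last by rewrite (head_sum_eps i std) ti.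
  by have := mem_root_short eps t false TB; rewrite scale1r.
(* The sign opposite to that in mu removes [e k] from the sum. *)
exists (e t - (-1) ^+ s *: e k); last first.
  by rewrite nuE muE addrACA subrr addr0.
have tk : t != k by rewrite (eps_head_coord ti ik).
apply: mem_g1.
  have := mem_root_pair T eps false (~~ s) tk; rewrite signrN scale1r scaleNr //.
rewrite head_sumD head_sumN head_sumZ !(head_sum_eps i std) ti leqNgt ik /=.
by rewrite mulr0 subr0.
Qed.

End SpecialConstituents.

Theorem proposition6p12 (R : realType) (V : vectType R[i]) (br : lieBracket V)
    (h : {vspace V}) (T : classicalType) (n : nat) (eps : n.-tuple (weight h))
    (i : 'I_n) (mu gamma : weight h) (lg : {vspace V})
    (W : {vspace tensor V}) (nu : weight h) :
  standard_realization br T eps ->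
  highest_weight br T eps i br (g1 br T eps i) mu ->
  highest_weight br T eps i br (zn br T eps i) gamma ->
  is_l_gamma br T eps i gamma lg ->
  constituent br T eps i (tens_space lg (zn br T eps i)) W nu ->
  ((T = TypeB /\ (3 <= i.+1 <= n)%N \/ T = TypeD /\ (3 <= i.+1 <= n - 3)%N) ->
     (special_constituent br T eps i mu gamma W nu <-> nu = eps`_0 *+ 2)) /\
  (T = TypeC /\ (2 <= i.+1 <= n - 1)%N ->
     (special_constituent br T eps i mu gamma W nu <-> nu = eps`_0 + eps`_1)).
Proof.
move=> std hw_mu hw_gamma lgP WP; have iN := ltn_ord i.
split=> [BD|[TC /andP[i1 i2]]].
  have n3 : (2 < n)%N by case: BD => -[_ /andP[]]; lia.
  have -> : eps`_0 *+ 2 = tnth eps (Ordinal (ltnW (ltnW n3))) +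
      tnth eps (if T is TypeC then Ordinal (ltnW n3) else Ordinal (ltnW (ltnW n3))).
    by rewrite mulr2n (eps_nth eps (ltnW (ltnW n3))); case: BD => -[-> _].
  apply: (special_constituent_iff std n3 _ _ _ _ hw_mu hw_gamma lgP WP).
  - by case: BD => -[-> _].
  - by case: BD => -[-> /andP[]] //; lia.
  - by case: BD => -[_ /andP[]]; lia.
  - by case: BD => -[_ /andP[]]; lia.
have n3 : (2 < n)%N by lia.
have -> : eps`_0 + eps`_1 = tnth eps (Ordinal (ltnW (ltnW n3))) +
    tnth eps (if T is TypeC then Ordinal (ltnW n3) else Ordinal (ltnW (ltnW n3))).
  by rewrite TC (eps_nth eps (ltnW (ltnW n3))) (eps_nth eps (ltnW n3)).
apply: (special_constituent_iff std n3 _ _ _ _ hw_mu hw_gamma lgP WP).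
- by move=> _; lia.
- by rewrite TC.
- by lia.
- by rewrite TC.
Qed.
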